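(* Let $d\ge2$, $K\ge1$ be integers, $J\ge0$ real and $\epsilon>0$. Let $|\Psi\rangle\in(\mathbb C^d)^{\otimes K}$ be a unit vector chosen uniformly at random (unitarily invariant measure), and $F^{(K,J)}_\Psi:=\langle\Psi|\mathcal E^{(K)}_J(|\Psi\rangle\langle\Psi|)|\Psi\rangle$. Then $$\mathrm{Prob}\big[F^{(K,J)}_\Psi<1-\epsilon\big]<\frac{2(K+1)^{\frac{d(d-1)}{2}}}{\epsilon}\exp\!\Big[-\frac{2J^2}{K}\Big].$$
   Context: Use the Schur–Weyl decomposition $(\mathbb C^d)^{\otimes K}\cong\bigoplus_{\lambda\in\mathsf Y_{K,d}}\mathcal R_\lambda\otimes\mathcal M_\lambda$, where $\mathsf Y_{K,d}$ is the set of Young diagrams $\lambda=(\lambda_1\ge\dots\ge\lambda_d\ge0)$ with $\sum_i\lambda_i=K$, $\mathcal R_\lambda$ carries the irreducible $SU(d)$-representation of highest weight $\lambda$ (on which $U^{\otimes K}$ acts irreducibly) and $\mathcal M_\lambda$ is the multiplicity space. Let $\mathsf Y^{(K)}_J:=\{\lambda\in\mathsf Y_{K,d}:\lambda_d\ge K/d-J\}$, $\mathcal H^{(K)}_J:=\bigoplus_{\lambda\in\mathsf Y^{(K)}_J}\mathcal R_\lambda\otimes\mathcal M_\lambda$, $P^{(K)}_J$ its orthogonal projector, $\rho_0$ a fixed density matrix supported in $\mathcal H^{(K)}_J$, and $\mathcal E^{(K)}_J(\rho):=P^{(K)}_J\rho P^{(K)}_J+\mathrm{Tr}[(I-P^{(K)}_J)\rho]\rho_0$.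 *)

(* Defs.v *)
(* MathComp + MathComp-Analysis, complex numbers R[i] from
   mathcomp-real-closed over an abstract R : realType. *)
From HB Require Import structures.
From mathcomp Require Import all_boot all_order all_algebra all_fingroup.
From mathcomp Require Import complex.
From mathcomp Require Import all_classical all_reals all_analysis.

Set Implicit Arguments.
Unset Strict Implicit.
Unset Printing Implicit Defensive.

Import Order.TTheory GRing.Theory Num.Theory.
Local Open Scope ring_scope.

Section SchurWeyl.
Variables (R : realType) (d K : nat).

(* Computational basis of (C^d)^{\otimes K}: words x : 'I_K -> 'I_d. *)
Definition word := {ffun 'I_K -> 'I_d}.
Definition dimH := #|{: word}|.

(* Complex N x N matrices, column-vector convention: operators act as A *m v. *)
Notation C := (R[i]).

(* Adjoint (conjugate transpose). *)
Definition adj m n (A : 'M[C]_(m, n)) : 'M[C]_(n, m) :=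
  (map_mx (fun z : C => z^*) A)^T.

(* Column space of A (as an mxalgebra subspace = row space of A^T). *)
Definition colspace m n (A : 'M[C]_(m, n)) := (A^T)%MS.

(* Action of sigma in S_K permuting the tensor factors:
   V_sigma e_x = e_{x o sigma^-1}.  sigma |-> V_sigma is a representation. *)
Definition Vperm (s : 'S_K) : 'M[C]_dimH :=
  \matrix_(i, j)
    (((@enum_val word predT i : word)
       == [ffun k => (@enum_val word predT j : word) ((s^-1)%g k)])%:R).

(* Young diagrams lambda = (lambda_1 >= ... >= lambda_d >= 0), sum = K,
   encoded as lam : 'I_d -> 'I_(K+1) (row r has lam r boxes). *)
Definition young (lam : {ffun 'I_d -> 'I_K.+1}) : bool :=
  [forall i : 'I_d, forall j : 'I_d, (i <= j)%N ==> (lam j <= lam i)%N]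
  && (\sum_(i < d) (lam i : nat) == K)%N.

(* lambda_d : the length of the last (d-th) row. *)
Definition lam_last (lam : {ffun 'I_d -> 'I_K.+1}) : nat :=
  (\sum_(i < d | val i == d.-1) (lam i : nat))%N.

(* Standard row-reading Young tableau of shape lam: boxes numbered 0..K-1
   row by row.  prefix r = number of boxes in rows < r. *)
Definition prefix (lam : {ffun 'I_d -> 'I_K.+1}) (r : nat) : nat :=
  (\sum_(i < d | (i < r)%N) (lam i : nat))%N.
(* row of box k *)
Definition rowof (lam : {ffun 'I_d -> 'I_K.+1}) (k : nat) : nat :=
  #|[set r : 'I_d | (prefix lam r.+1 <= k)%N]|.
(* column of box k *)
Definition colof (lam : {ffun 'I_d -> 'I_K.+1}) (k : nat) : nat :=
  (k - prefix lam (rowof lam k))%N.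

(* Row and column stabilisers of the tableau. *)
Definition rowstab lam (s : 'S_K) : bool :=
  [forall k : 'I_K, rowof lam (s k) == rowof lam k].
Definition colstab lam (s : 'S_K) : bool :=
  [forall k : 'I_K, colof lam (s k) == colof lam k].

(* Young symmetrizer c_lambda = a_lambda b_lambda acting on (C^d)^{\otimes K}. *)
Definition a_sym lam : 'M[C]_dimH := \sum_(p : 'S_K | rowstab lam p) Vperm p.
Definition b_sym lam : 'M[C]_dimH :=
  \sum_(q : 'S_K | colstab lam q) ((-1) ^+ odd_perm q) *: Vperm q.
Definition c_sym lam : 'M[C]_dimH := a_sym lam *m b_sym lam.

(* The lambda-isotypic component R_lambda (x) M_lambda of (C^d)^{\otimes K}:
   the image of the two-sided ideal of C[S_K] generated by c_lambda, i.e.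
   sum over sigma of the column spaces of V_sigma c_lambda. *)
Definition isotypic lam := (\sum_(s : 'S_K) colspace (Vperm s *m c_sym lam))%MS.

(* H^{(K)}_J = sum of isotypic components with lambda_d >= K/d - J. *)
Definition HJ (J : R) :=
  (\sum_(lam : {ffun 'I_d -> 'I_K.+1}
           | young lam && ((K%:R / d%:R - J <= (lam_last lam)%:R :> R)))
     isotypic lam)%MS.

(* P is the orthogonal projector onto the subspace W. *)
Definition orth_proj (P : 'M[C]_dimH) (W : 'M[C]_dimH) : Prop :=
  P *m P = P /\ adj P = P /\ (colspace P == W)%MS.

(* Density matrix. *)
Definition density (rho : 'M[C]_dimH) : Prop :=
  \tr rho = 1 /\ forall v : 'cV[C]_dimH, 0 <= (adj v *m rho *m v) 0 0.

(* The channel E^{(K)}_J given the projector P and the fixed state rho0. *)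
Definition chanE (P rho0 rho : 'M[C]_dimH) : 'M[C]_dimH :=
  P *m rho *m P + \tr ((1%:M - P) *m rho) *: rho0.

(* Fidelity F_Psi = <Psi| E(|Psi><Psi|) |Psi> (a real number; we take Re). *)
Definition fid (P rho0 : 'M[C]_dimH) (psi : 'cV[C]_dimH) : R :=
  complex.Re ((adj psi *m chanE P rho0 (psi *m adj psi) *m psi) 0 0).

(* Borel sigma-algebra on C^N (= R^{2N}), generated by coordinate half-spaces. *)
Definition cBorel : set (set 'cV[C]_dimH) :=
  (<<s setT,
     [set A | exists (i : 'I_dimH) (a : R),
        A = [set v : 'cV[C]_dimH | complex.Re (v i 0) < a] \/
        A = [set v : 'cV[C]_dimH | complex.Im (v i 0) < a]] >>)%classic.

Definition unitary (U : 'M[C]_dimH) : Prop := adj U *m U = 1%:M.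

End SchurWeyl.

(* Main.v *)
(** A weight argument bounds the rank of [Q = 1 - P] without any character
    theory.  Let [W] be the kernel of [P].  It is stable under the raising
    operators, and under the Borel part of the commutant of the symmetric group.
    If [w] in [W] is sent by this Borel algebra to vectors with no component on
    the bad words (those with fewer than [K/d - J] occurrences of the last
    letter), then applying raising operators repeatedly produces a
    highest-weight vector of [W] with the same property.  Its component of
    weight [mu] vanishes: by sl_2 theory if [mu] is not dominant; otherwise [mu]
    is the shape of a good diagram, every row-symmetrisation of the component
    is a multiple of the highest-weight vector [c_mu e_mu] of [HJ], and
    [W] meets [HJ] trivially.  Hence [w = 0].  The functionals involved are
    indexed by a bad word and, for each pair of letters [a < b], a number of
    positions; so [rank Q] is at most [(K+1)^(d(d-1)/2)] times the number of
    bad words, which Hoeffding's inequality bounds by [d^K exp(-2 J^2/K)].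

    On the probabilistic side, [1 - F <= 2 <Psi|Q|Psi>], and averaging over
    signed permutation matrices shows that [<Psi|Q|Psi>] has expectation
    [rank Q / d^K]; Markov's inequality concludes. *)
Require Import Defs.
From HB Require Import structures.
From mathcomp Require Import all_boot all_order all_algebra all_fingroup.
From mathcomp Require Import complex.
From mathcomp Require Import all_classical all_reals all_analysis.
From mathcomp Require Import measurable_realfun.
From mathcomp Require Import ring lra zify.
Import Order.TTheory GRing.Theory Num.Theory.
Local Open Scope ring_scope.

Set Implicit Arguments.
Unset Strict Implicit.
Unset Printing Implicit Defensive.

(** * Words and operators on the tensor power *)

Section Words.
Variables d K : nat.
Implicit Types (x y : word d K) (k l : 'I_K) (i j : 'I_d) (s t : 'S_K).

Definition wperm x s : word d K := [ffun k => x (s k)].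
Definition upd x k j : word d K := [ffun l => if l == k then j else x l].
Definition count_letter x i : nat := #|[set k | x k == i]|.

Lemma wpermM x s t : wperm (wperm x s) t = wperm x (t * s)%g.
Proof. by apply/ffunP=> k; rewrite !ffunE permM. Qed.

Lemma wperm1 x : wperm x 1%g = x.
Proof. by apply/ffunP=> k; rewrite !ffunE perm1. Qed.

Lemma wpermK s : cancel (wperm^~ s) (wperm^~ s^-1%g).
Proof. by move=> x; rewrite wpermM mulVg wperm1. Qed.

Lemma wperm_upd x s k j : wperm (upd x (s k) j) s = upd (wperm x s) k j.
Proof. by apply/ffunP=> l; rewrite !ffunE (inj_eq perm_inj). Qed.

Lemma upd_upd x k i j : upd (upd x k i) k j = upd x k j.
Proof. by apply/ffunP=> l; rewrite !ffunE; case: eqP. Qed.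

Lemma upd_id x k : upd x k (x k) = x.
Proof. by apply/ffunP=> l; rewrite !ffunE; case: eqP => [->|]. Qed.

Lemma upd_at x k j : upd x k j k = j.
Proof. by rewrite ffunE eqxx. Qed.

Lemma upd_ne x k l j : l != k -> upd x k j l = x l.
Proof. by rewrite ffunE => /negbTE ->. Qed.

Lemma updC x k l i j : k != l -> upd (upd x k i) l j = upd (upd x l j) k i.
Proof.
move=> nkl; apply/ffunP=> m; rewrite !ffunE.
by case: (m =P l) => [->|//]; rewrite eq_sym (negbTE nkl).
Qed.

Lemma count_wperm x s i : count_letter (wperm x s) i = count_letter x i.
Proof.
rewrite /count_letter -[RHS](card_preimset _ (@perm_inj _ s)).
by apply: eq_card => k; rewrite !inE ffunE.
Qed.

(** Equal fibre sizes make the two tuples of values equal as multisets. The type [T] is arbitrary so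
    as to serve words and pairs of words alike. *)
Lemma perm_of_fibers (T : finType) (f g : 'I_K -> T) :
  (forall a, #|[set k | f k == a]| = #|[set k | g k == a]|) ->
  exists s : 'S_K, forall k, g k = f (s k).
Proof.
move=> fg.
have: perm_eq [tuple g k | k < K] [tuple f k | k < K].
  apply/allP => a _ /=.
  have cnt (h : 'I_K -> T) : count_mem a [tuple h k | k < K] = #|[set k | h k == a]|.
    by rewrite /= count_map -sum1_count -sum1dep_card big_enum_cond.
  by rewrite !cnt fg.
case/tuple_permP => s gs; exists s => k.
have gE : [tuple g k | k < K] = [tuple tnth [tuple f k | k < K] (s k) | k < K].
  exact: val_inj.
by have := congr1 (fun u => tnth u k) gE; rewrite !tnth_mktuple.
Qed.

Lemma same_content_perm x y :
  (forall i, count_letter x i = count_letter y i) -> exists s, y = wperm x s.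
Proof.
move=> xy; have [s sP] := perm_of_fibers xy.
by exists s; apply/ffunP => k; rewrite ffunE sP.
Qed.

Lemma sum_count_letter x (f : 'I_d -> nat) :
  (\sum_k f (x k) = \sum_i count_letter x i * f i)%N.
Proof.
rewrite (partition_big x predT) //=; apply: eq_bigr => i _.
rewrite (eq_bigr (fun=> f i)); last by move=> k /eqP ->.
by rewrite sum_nat_const /count_letter cardsE.
Qed.

Lemma sum_count_letter1 x : (\sum_i count_letter x i = K)%N.
Proof.
rewrite -[RHS]card_ord -sum1_card (sum_count_letter x (fun=> 1%N)).
by apply: eq_bigr => i _; rewrite muln1.
Qed.

Lemma count_letter_le x i : (count_letter x i <= K)%N.
Proof. by rewrite -[X in (_ <= X)%N]card_ord max_card. Qed.

Lemma count_letterE x i : count_letter x i = (\sum_k (x k == i))%N.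
Proof. by rewrite /count_letter -sum1_card big_mkcond; apply: eq_bigr => k _; rewrite inE. Qed.

Lemma sum_upd x k j (f : 'I_d -> nat) :
  (\sum_l f (upd x k j l) + f (x k) = \sum_l f (x l) + f j)%N.
Proof.
rewrite (bigD1 k) //= [in RHS](bigD1 k) //= upd_at.
rewrite (eq_bigr (fun l => f (x l))); last by move=> l lk; rewrite upd_ne.
by rewrite [LHS]addnC [(f j + _)%N]addnC addnA.
Qed.

Lemma count_upd x k j a :
  (count_letter (upd x k j) a + (x k == a) = count_letter x a + (j == a))%N.
Proof. by rewrite !count_letterE (sum_upd x k j (fun b => (b == a) : nat)). Qed.

End Words.

(** * Permutation, matrix-unit and weight operators in the basis of words *)

Section Operators.
Variables (R : realType) (d K : nat).
Notation C := R[i].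
Notation N := (dimH d K).
Notation W := (word d K).
Implicit Types (x y : W) (k l : 'I_K) (i j : 'I_d) (s t : 'S_K).
Implicit Types (v w : 'cV[C]_N) (A B : 'M[C]_N).

Definition amp v x : C := v (enum_rank x) 0.
Definition entry A x y : C := A (enum_rank x) (enum_rank y).
Definition opmx (f : W -> W -> C) : 'M[C]_N :=
  \matrix_(a, b) f (enum_val a) (enum_val b).
Definition ket y : 'cV[C]_N := \col_a (enum_val a == y)%:R.

Lemma amp_inj v w : amp v =1 amp w -> v = w.
Proof.
move=> vw; apply/colP => a; rewrite -(enum_valK a).
exact: vw.
Qed.

Lemma amp_ket y x : amp (ket y) x = (x == y)%:R.
Proof. by rewrite /amp mxE enum_rankK. Qed.

Lemma ampM A v x : amp (A *m v) x = \sum_y entry A x y * amp v y.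
Proof.
rewrite /amp mxE (reindex_onto (@enum_rank W) enum_val) /=; last first.
  by move=> a _; rewrite enum_valK.
by apply: eq_bigl => y; rewrite enum_rankK eqxx.
Qed.

Lemma ampB v w x : amp (v - w) x = amp v x - amp w x.
Proof. by rewrite /amp !mxE. Qed.

Lemma ampZ a v x : amp (a *: v) x = a * amp v x.
Proof. by rewrite /amp mxE. Qed.

Lemma amp0 x : amp 0 x = 0.
Proof. by rewrite /amp mxE. Qed.

Lemma amp_sum (I : finType) (Q : pred I) (F : I -> 'cV[C]_N) x :
  amp (\sum_(a | Q a) F a) x = \sum_(a | Q a) amp (F a) x.
Proof. by rewrite /amp summxE. Qed.

Lemma entryE A x y : entry A x y = amp (A *m ket y) x.
Proof.
rewrite ampM (bigD1 y) //= amp_ket eqxx mulr1 big1 ?addr0 // => z /negbTE zy.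
by rewrite amp_ket zy mulr0.
Qed.

Lemma entry_opmx f x y : entry (opmx f) x y = f x y.
Proof. by rewrite /entry mxE !enum_rankK. Qed.

Lemma op_ext A B : (forall v x, amp (A *m v) x = amp (B *m v) x) -> A = B.
Proof.
move=> AB; apply/matrixP => a b; rewrite -(enum_valK a) -(enum_valK b).
by rewrite -/(entry A _ _) -/(entry B _ _) !entryE AB.
Qed.

Lemma amp_Vperm s v x : amp (Vperm R d s *m v) x = amp v (wperm x s).
Proof.
rewrite ampM (bigD1 (wperm x s)) //= big1 ?addr0 => [|y ne].
  rewrite /entry mxE !enum_rankK -/(wperm (wperm x s) s^-1%g) wpermK eqxx.
  by rewrite mul1r.
rewrite /entry mxE !enum_rankK -/(wperm y s^-1%g); case: eqP => [xE|]; last by rewrite mul0r.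
by case/eqP: ne; rewrite xE wpermM mulgV wperm1.
Qed.

(** Permutations compose from left to right, [(t * s)%g] sending [k] to [s (t k)], so this is the
    usual homomorphism law. *)
Lemma VpermM s t : Vperm R d s *m Vperm R d t = Vperm R d (t * s)%g.
Proof. by apply: op_ext => v x; rewrite -mulmxA !amp_Vperm wpermM. Qed.

Lemma Vperm1 : @Vperm R d K 1%g = 1%:M.
Proof. by apply: op_ext => v x; rewrite amp_Vperm wperm1 mul1mx. Qed.

Lemma adjM m n p (A : 'M[C]_(m, n)) (B : 'M[C]_(n, p)) : adj (A *m B) = adj B *m adj A.
Proof. by rewrite /adj map_mxM trmx_mul. Qed.

Lemma adjK m n (A : 'M[C]_(m, n)) : adj (adj A) = A.
Proof. by apply/matrixP => a b; rewrite !mxE conjCK. Qed.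

Lemma adjB m n (A B : 'M[C]_(m, n)) : adj (A - B) = adj A - adj B.
Proof. by rewrite /adj map_mxB linearB. Qed.

Lemma adj_id n : adj (1%:M : 'M[C]_n) = 1%:M.
Proof. by rewrite /adj map_mx1 trmx1. Qed.

Lemma entry_adj A x y : entry (adj A) x y = (entry A y x)^*.
Proof. by rewrite /entry !mxE. Qed.

Lemma entryP A B : (forall x y, entry A x y = entry B x y) -> A = B.
Proof.
move=> AB; apply/matrixP => a b; rewrite -(enum_valK a) -(enum_valK b).
exact: AB.
Qed.

(* The derivation of the tensor power extending the matrix unit e_j |-> e_i. *)
Definition unitop i j : 'M[C]_N :=
  opmx (fun x y => \sum_(k | x k == i) (y == upd x k j)%:R).

Lemma amp_unitop i j v x :
  amp (unitop i j *m v) x = \sum_(k | x k == i) amp v (upd x k j).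
Proof.
rewrite ampM.
under eq_bigr do rewrite entry_opmx mulr_suml.
rewrite exchange_big /=; apply: eq_bigr => k _.
rewrite (bigD1 (upd x k j)) //= eqxx mul1r big1 ?addr0 // => y /negbTE ->.
by rewrite mul0r.
Qed.

Definition equivariant A := forall s, A *m Vperm R d s = Vperm R d s *m A.

Lemma unitop_equivariant i j : equivariant (unitop i j).
Proof.
move=> s; apply: op_ext => v x; rewrite -!mulmxA amp_Vperm !amp_unitop.
rewrite [RHS](reindex_inj (@perm_inj _ s^-1%g)) /=.
apply: eq_big => [k|k _]; first by rewrite ffunE permKV.
by rewrite amp_Vperm -{1}(permKV s k) wperm_upd.
Qed.

Lemma adj_unitop i j : adj (unitop i j) = unitop j i.
Proof.
apply: entryP => x y; rewrite entry_adj !entry_opmx rmorph_sum /=.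
rewrite big_mkcond [RHS]big_mkcond; apply: eq_bigr => k _ /=.
case: (y k =P i) => [yk|yk]; case: (x k =P j) => [xk|xk] //.
- rewrite rmorph_nat; congr (_%:R); congr nat_of_bool.
  by apply/eqP/eqP => ->; rewrite upd_upd -?xk -?yk upd_id.
- by case: eqP => [xE|_]; rewrite ?rmorph0 //; case: xk; rewrite xE upd_at.
- by case: eqP => [yE|_] //; case: yk; rewrite yE upd_at.
Qed.

(** The orthogonal projector onto the space of weight [mu]. *)
Definition contentproj (mu : 'I_d -> nat) : 'M[C]_N :=
  opmx (fun x y => ((x == y) && [forall i, count_letter x i == mu i])%:R).

Lemma amp_contentproj mu v x :
  amp (contentproj mu *m v) x =
    if [forall i, count_letter x i == mu i] then amp v x else 0.
Proof.
rewrite ampM (bigD1 x) //= entry_opmx eqxx big1 ?addr0 => [|y ne].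
  by case: ifP; rewrite ?mul1r ?mul0r.
by rewrite entry_opmx eq_sym (negbTE ne) mul0r.
Qed.

Lemma contentproj_equivariant mu : equivariant (contentproj mu).
Proof.
move=> s; apply: op_ext => v x; rewrite -!mulmxA amp_Vperm !amp_contentproj amp_Vperm.
by under [in RHS]eq_forallb do rewrite count_wperm.
Qed.

Lemma adj_contentproj mu : adj (contentproj mu) = contentproj mu.
Proof.
apply: entryP => x y; rewrite entry_adj !entry_opmx rmorph_nat.
by rewrite eq_sym; case: eqP => [->|].
Qed.

Lemma adj_Vperm s : adj (Vperm R d s) = Vperm R d s^-1%g.
Proof.
apply: entryP => x y; rewrite entry_adj !entryE !amp_Vperm !amp_ket rmorph_nat.
congr (_%:R); congr nat_of_bool.
by apply/eqP/eqP => <-; rewrite wpermM ?mulgV ?mulVg wperm1.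
Qed.

Lemma equivariantM A B : equivariant A -> equivariant B -> equivariant (A *m B).
Proof. by move=> hA hB s; rewrite -mulmxA hB mulmxA hA mulmxA. Qed.

Lemma equivariant1 : equivariant 1%:M.
Proof. by move=> s; rewrite mul1mx mulmx1. Qed.

(** Conjugation by [Vperm s] fixes [A]. Entries thus depend only on the orbit of a pair of words,
    which is why few functionals suffice for the rank bound. *)
Lemma equivariant_entry A x y s :
  equivariant A -> entry A (wperm x s) (wperm y s) = entry A x y.
Proof.
move=> hA; rewrite !entryE -amp_Vperm mulmxA -hA -mulmxA.
congr (amp (_ *m _) _); apply: amp_inj => z; rewrite amp_Vperm !amp_ket.
by rewrite (can_eq (@wpermK _ _ s)).
Qed.

End Operators.

(** * Highest-weight vectors *)

Section Rigidity.
Variables (F : numDomainType) (d K : nat).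
Implicit Types (x y : word d K) (u : word d K -> F).

(* With [r = xl k0 < j = x k0], the relation attached to [upd x k0 r] equates a
   positive multiple of [u x] to values of [u] at words closer to [xl]. *)
Lemma highest_weight_rigid (xl : word d K) u :
  (forall x k l, xl k = xl l -> u (wperm x (tperm k l)) = u x) ->
  (forall (i j : 'I_d) x, (i < j)%N -> \sum_(k | x k == i) u (upd x k j) = 0) ->
  (forall x, u x != 0 -> forall i, count_letter x i = count_letter xl i) ->
  u xl = 0 -> forall x, u x = 0.
Proof.
move=> uR uE uC uxl x.
(* Induction on the number of positions where [x] differs from [xl]. *)
have [n] := ubnP #|[set k | x k != xl k]|; elim: n x => // n IHn x le_n.
have [//|ux] := eqVneq (u x) 0.
have [xE|nxE] := eqVneq x xl; first by rewrite xE.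
(* Both words have the same letter sum, so unless they coincide some letter of [x] exceeds that of
   [xl]. *)
have [k0 ltk0] : exists k, (xl k < x k)%N.
  apply/existsP; apply: contraT; rewrite negb_exists => /forallP le_x.
  have sumE : (\sum_k (x k : nat) = \sum_k (xl k : nat))%N.
    rewrite !(sum_count_letter _ (@nat_of_ord d)).
    by apply: eq_bigr => i _; rewrite uC.
  have le_x' k : (x k <= xl k)%N by rewrite leqNgt le_x.
  have /eqP : (\sum_k (xl k - x k) = 0)%N by rewrite sumnB // sumE subnn.
  rewrite sum_nat_eq0 => /forallP sub0.
  case/eqP: nxE; apply/ffunP => k; apply: val_inj; apply/eqP.
  by rewrite eqn_leq le_x' -subn_eq0; apply: (implyP (sub0 k)).
pose r := xl k0; pose j := x k0; pose y := upd x k0 r.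
have := uE r j y ltk0; rewrite (bigID (fun k => xl k == r)) /=.
rewrite [X in _ + X]big1 => [|k /andP[/eqP yk /eqP xlk]]; last first.
  have nk : k != k0 by apply: contra_notN xlk => /eqP ->.
  have xk : x k = r by rewrite -yk upd_ne.
  apply: IHn; rewrite ltnS in le_n; apply: leq_trans le_n; apply: proper_card; apply/properP; split.
    apply/fintype.subsetP => l; rewrite !inE /y.
    have [-> _|nlk] := eqVneq l k; first by rewrite xk eq_sym; apply/eqP.
    rewrite upd_ne //; have [->|nl0] := eqVneq l k0; last by rewrite upd_ne.
    by rewrite upd_at eqxx.
  exists k0; rewrite inE; first by rewrite neq_ltn [X in _ || X]ltk0 orbT.
  by rewrite upd_ne 1?eq_sym // upd_at eqxx.
rewrite addr0 (eq_bigr (fun=> u x)) => [|k /andP[/eqP yk /eqP xlk]]; last first.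
  (* Here [upd y k j] is [x] with positions [k] and [k0] exchanged, both in row [r] of [xl]. *)
  rewrite -(uR x k k0) ?xlk //; congr u; apply/ffunP => l; rewrite !ffunE.
  case: tpermP => [->|->|/eqP nk /eqP nk0]; rewrite ?eqxx //.
    have [kk|nkk] := eqVneq k0 k; first by rewrite -kk.
    by rewrite -yk /y upd_ne 1?eq_sym // eqxx.
  by rewrite (negbTE nk) (negbTE nk0).
rewrite sumr_const -mulr_natr => /eqP; rewrite mulf_eq0 => /orP[/eqP //|].
rewrite pnatr_eq0 => /eqP/card0_eq/(_ k0).
by rewrite unfold_in /y upd_at !eqxx.
Qed.
End Rigidity.

(** * Combinatorics of the row-reading tableau *)

Section Tableau.
Variables (d K : nat) (lam : {ffun 'I_d -> 'I_K.+1}).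
Hypothesis sum_lam : (\sum_(i < d) (lam i : nat))%N = K.

Lemma prefix0 : Defs.prefix lam 0 = 0%N.
Proof. by rewrite /Defs.prefix big_pred0. Qed.

Lemma prefixd : Defs.prefix lam d = K.
Proof. by rewrite -[RHS]sum_lam; apply: eq_bigl => i; rewrite ltn_ord. Qed.

Lemma prefixS (i : 'I_d) : Defs.prefix lam i.+1 = (Defs.prefix lam i + lam i)%N.
Proof.
rewrite /Defs.prefix (bigD1 i) //= addnC; congr addn; apply: eq_bigl => j.
by rewrite ltnS ltn_neqAle andbC.
Qed.

Lemma leq_prefix m n : (m <= n)%N -> (Defs.prefix lam m <= Defs.prefix lam n)%N.
Proof.
move=> mn; rewrite /Defs.prefix [X in (_ <= X)%N](bigID (fun i : 'I_d => (i < m)%N)) /=.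
rewrite (eq_bigl (fun i : 'I_d => (i < n)%N && (i < m)%N)) ?leq_addr // => i.
by case: ltnP => [/leq_trans->|]; rewrite ?andbF.
Qed.

Lemma prefixS_le (i : 'I_d) : (Defs.prefix lam i.+1 <= K)%N.
Proof. by apply: leq_trans (leq_prefix (ltn_ord i)) _; rewrite prefixd. Qed.

Lemma card_ord_lt m n : (m <= n)%N -> #|[set i : 'I_n | (i < m)%N]| = m.
Proof.
move=> mn; rewrite -sum1dep_card -(big_ord_widen n (fun=> 1%N) mn).
by rewrite sum1_card card_ord.
Qed.

(** The least [n] with [k < prefix lam n] is nonzero, and its predecessor is the row. *)
Lemma exists_row (k : 'I_K) :
  exists i : 'I_d, (Defs.prefix lam i <= k < Defs.prefix lam i.+1)%N.
Proof.
have ex : exists n, (k < Defs.prefix lam n)%N by exists d; rewrite prefixd.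
case: (ex_minnP ex) => -[|m]; first by rewrite prefix0.
move=> km min_m; have md : (m < d)%N by apply: min_m; rewrite prefixd.
exists (Ordinal md); rewrite km andbT leqNgt; apply/negP => /min_m.
by rewrite ltnn.
Qed.

Lemma rowof_eq (i : 'I_d) k : (Defs.prefix lam i <= k < Defs.prefix lam i.+1)%N ->
  rowof lam k = i.
Proof.
case/andP => ik ki; rewrite /rowof -[RHS](@card_ord_lt _ d); last exact: ltnW.
apply: eq_card => j; rewrite !inE.
apply/idP/idP => [jk|ji]; last by apply: leq_trans ik; exact: leq_prefix.
rewrite ltnNge; apply/negP => ij.
by have := leq_trans ki (leq_trans (leq_prefix (ij : i.+1 <= j.+1)%N) jk); rewrite ltnn.
Qed.

(** This word writes [i] in every box of row [i]; the highest-weight vector is built from it. *)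
Lemma exists_rowword : exists xl : word d K,
  forall k : 'I_K, (Defs.prefix lam (xl k) <= k < Defs.prefix lam (xl k).+1)%N.
Proof. by exists [ffun k => xchoose (exists_row k)] => k; rewrite ffunE; exact: (xchooseP (exists_row k)). Qed.

Variable xl : word d K.
Hypothesis xlP : forall k : 'I_K, (Defs.prefix lam (xl k) <= k < Defs.prefix lam (xl k).+1)%N.

Lemma rowof_word (k : 'I_K) : rowof lam k = xl k.
Proof. exact: rowof_eq. Qed.

Lemma colof_word (k : 'I_K) : colof lam k = (k - Defs.prefix lam (xl k))%N.
Proof. by rewrite /colof rowof_word. Qed.

Lemma count_rowword i : count_letter xl i = lam i.
Proof.
have pK := prefixS_le i.
have pp : (Defs.prefix lam i <= Defs.prefix lam i.+1)%N by apply: leq_prefix.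
rewrite -(addKn (Defs.prefix lam i) (lam i)) -prefixS.
rewrite -{1}(card_ord_lt pK) -(card_ord_lt (leq_trans pp pK)).
rewrite -cardsDS; last by apply/fintype.subsetP => k; rewrite !inE => /leq_trans->.
apply: eq_card => k; rewrite !inE -leqNgt.
apply/eqP/idP => [<-|ki]; first exact: xlP.
by apply: val_inj; rewrite /= -rowof_word (rowof_eq ki).
Qed.

Lemma row_col_inj (k l : 'I_K) : xl k = xl l -> colof lam k = colof lam l -> k = l.
Proof.
move=> rkl; rewrite !colof_word rkl => ckl; apply: val_inj => /=.
have /andP[lk _] := xlP k; have /andP[ll _] := xlP l; rewrite rkl in lk.
by rewrite -(subnK lk) ckl subnK.
Qed.

(** The column index of [k] is below [lam (xl k)], hence below [lam i], so row [i] reaches that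
    column. *)
Lemma box_above (i : 'I_d) (k : 'I_K) : (lam (xl k) <= lam i)%N ->
  exists l : 'I_K, xl l = i /\ colof lam l = colof lam k.
Proof.
move=> lamk; have /andP[k1 k2] := xlP k.
have pK := prefixS_le i.
rewrite prefixS in k2; rewrite prefixS in pK.
have lt : (Defs.prefix lam i + (k - Defs.prefix lam (xl k)) < K)%N by lia.
have rowl : rowof lam (Ordinal lt) = i by apply: rowof_eq; rewrite prefixS /=; lia.
exists (Ordinal lt); have xlE : xl (Ordinal lt) = i.
  by apply: val_inj; rewrite /= -rowof_word.
by split=> //; rewrite !colof_word xlE /= addKn.
Qed.

End Tableau.

Section Stabiliser.
Variables (K : nat) (f : nat -> nat).

(** Taking [f] to be [rowof lam] or [colof lam] covers [rowstab] and [colstab] at once. *)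
Let stab (s : 'S_K) := [forall k : 'I_K, f (s k) == f k].

Lemma stabMl (s t : 'S_K) : stab t -> stab (t * s)%g = stab s.
Proof.
move=> /forallP st; apply/forallP/forallP => ss k; last first.
  by rewrite permM (eqP (ss _)) (eqP (st k)).
have := ss (t^-1%g k); rewrite permM permKV => /eqP ->.
by rewrite -(eqP (st _)) permKV.
Qed.

Lemma stabMr (s t : 'S_K) : stab t -> stab (s * t)%g = stab s.
Proof.
move=> /forallP st; apply/forallP/forallP => ss k.
  by rewrite -(eqP (st _)) -permM.
by rewrite permM (eqP (st _)).
Qed.

Lemma stab_tperm (k l : 'I_K) : f k = f l -> stab (tperm k l).
Proof. by move=> fkl; apply/forallP => m; case: tpermP => [->|->|]; rewrite ?fkl. Qed.

End Stabiliser.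

(** * The Young symmetrizer and its highest-weight vector *)

Section YoungSymmetrizer.
Variables (R : realType) (d K : nat) (lam : {ffun 'I_d -> 'I_K.+1}).
Notation C := R[i].
Notation N := (dimH d K).
Implicit Types (v w : 'cV[C]_N) (A B : 'M[C]_N) (x y : word d K).

Lemma equivariant_a_sym A : equivariant A -> A *m a_sym R lam = a_sym R lam *m A.
Proof.
by move=> hA; rewrite mulmx_sumr mulmx_suml; apply: eq_bigr => s _; rewrite hA.
Qed.

Lemma equivariant_b_sym A : equivariant A -> A *m b_sym R lam = b_sym R lam *m A.
Proof.
move=> hA; rewrite mulmx_sumr mulmx_suml; apply: eq_bigr => s _.
by rewrite -scalemxAr hA scalemxAl.
Qed.

Lemma equivariant_c_sym A : equivariant A -> A *m c_sym R lam = c_sym R lam *m A.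
Proof.
move=> hA; rewrite /c_sym mulmxA equivariant_a_sym // -!mulmxA.
by rewrite equivariant_b_sym.
Qed.

Lemma Vperm_a_sym p : rowstab lam p -> Vperm R d p *m a_sym R lam = a_sym R lam.
Proof.
move=> stp; rewrite mulmx_sumr [RHS](reindex_inj (mulIg p)) /=.
apply: eq_big => [s|s _]; last by rewrite VpermM.
by rewrite /rowstab stabMr.
Qed.

Lemma amp_a_sym v x :
  amp (a_sym R lam *m v) x = \sum_(p | rowstab lam p) amp v (wperm x p).
Proof.
rewrite mulmx_suml amp_sum; apply: eq_bigr => p _.
by rewrite amp_Vperm.
Qed.

Lemma amp_b_sym v x :
  amp (b_sym R lam *m v) x =
    \sum_(q | colstab lam q) (-1) ^+ odd_perm q * amp v (wperm x q).
Proof.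
rewrite mulmx_suml amp_sum; apply: eq_bigr => q _.
by rewrite -scalemxAl ampZ amp_Vperm.
Qed.

(** Multiplication by the transposition permutes the column stabiliser and flips every sign. *)
Lemma b_sym_tperm (k l : 'I_K) : k != l -> colof lam k = colof lam l ->
  b_sym R lam *m Vperm R d (tperm k l) = - b_sym R lam.
Proof.
move=> kl ckl; rewrite mulmx_suml [in RHS]/b_sym [in RHS](reindex_inj (mulgI (tperm k l))) /=.
rewrite -sumrN; apply: eq_big => [s|s _].
  by rewrite /colstab [RHS]stabMl // stab_tperm.
by rewrite -scalemxAl VpermM odd_mul_tperm kl addTb signrN scaleNr opprK.
Qed.

(** The transposition fixes the ket but negates [b_sym], so the vector equals its own negative. *)
Lemma b_sym_ket0 (k l : 'I_K) y : k != l -> colof lam k = colof lam l ->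
  y k = y l -> b_sym R lam *m ket R y = 0.
Proof.
move=> kl ckl ykl.
have yE : Vperm R d (tperm k l) *m ket R y = ket R y.
  apply: amp_inj => x; rewrite amp_Vperm !amp_ket; congr (_%:R).
  have ytE : wperm y (tperm k l) = y.
    by apply/ffunP => m; rewrite ffunE; case: tpermP => [->|->|].
  by rewrite -{1}ytE (can_eq (@wpermK _ _ (tperm k l))).
have : b_sym R lam *m ket R y = - (b_sym R lam *m ket R y).
  by rewrite -{1}yE mulmxA b_sym_tperm // mulNmx.
move/eqP; rewrite -addr_eq0 -mulr2n -scaler_nat scaler_eq0 pnatr_eq0 /=.
by move/eqP.
Qed.

Hypothesis sum_lam : (\sum_(i < d) (lam i : nat))%N = K.
Variable xl : word d K.
Hypothesis xlP :
  forall k : 'I_K, (Defs.prefix lam (xl k) <= k < Defs.prefix lam (xl k).+1)%N.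

Definition young_vec : 'cV[C]_N := c_sym R lam *m ket R xl.

Lemma rowstab_word p : rowstab lam p -> wperm xl p = xl.
Proof.
move/forallP => st; apply/ffunP => k; apply: val_inj; rewrite ffunE /=.
by rewrite -!(rowof_word xlP) (eqP (st k)).
Qed.

Lemma tperm_rowstab (k l : 'I_K) : xl k = xl l -> rowstab lam (tperm k l).
Proof. by move=> kl; apply: stab_tperm; rewrite !(rowof_word xlP) kl. Qed.

Lemma rowstab1 : rowstab lam (1%g : 'S_K).
Proof. by apply/forallP => k; rewrite perm1. Qed.

Lemma amp_a_sym_word v :
  amp (a_sym R lam *m v) xl = #|[set p : 'S_K | rowstab lam p]|%:R * amp v xl.
Proof.
rewrite amp_a_sym (eq_bigr (fun=> amp v xl)) => [|p stp].
  by rewrite sumr_const mulr_natl; congr (_ *+ _); apply: eq_card => p; rewrite inE.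
by rewrite rowstab_word.
Qed.

Lemma card_rowstab_neq0 : #|[set p : 'S_K | rowstab lam p]|%:R != 0 :> C.
Proof.
by rewrite pnatr_eq0 -lt0n; apply/card_gt0P; exists 1%g; rewrite inE rowstab1.
Qed.

(* Only the identity preserves both the rows and the columns. *)
Lemma young_vec_neq0 : amp young_vec xl != 0.
Proof.
rewrite /young_vec -mulmxA amp_a_sym_word mulf_neq0 ?card_rowstab_neq0 //.
rewrite amp_b_sym (bigD1 1%g) /=; last by apply/forallP => k; rewrite perm1.
rewrite wperm1 amp_ket eqxx odd_perm1 mulr1 big1 ?addr0 ?oner_eq0 //.
move=> q /andP[/forallP stq q1]; rewrite amp_ket; case: eqP => [qxl|]; last by rewrite mulr0.
case/eqP: q1; apply/permP => k; rewrite perm1; apply: (row_col_inj xlP).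
  by rewrite -{2}qxl ffunE.
exact/eqP.
Qed.

Lemma a_sym_inv v p x : rowstab lam p ->
  amp (a_sym R lam *m v) (wperm x p) = amp (a_sym R lam *m v) x.
Proof. by move=> stp; rewrite -amp_Vperm mulmxA Vperm_a_sym. Qed.

(** The operator commutes with [c_sym] and turns one letter [j] of [xl] into [i]. By dominance row
    [i] has a box in the same column, and [b_sym] annihilates a word with equal letters in one
    column. *)
Lemma unitop_young_vec (i j : 'I_d) :
  (forall a b : 'I_d, (a <= b)%N -> (lam b <= lam a)%N) -> (i < j)%N ->
  unitop R K i j *m young_vec = 0.
Proof.
move=> dom ij.
rewrite /young_vec mulmxA equivariant_c_sym; last exact: unitop_equivariant.
rewrite -mulmxA; have -> : unitop R K i j *m ket R xl =
    \sum_(k | xl k == j) ket R (upd xl k i).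
  apply: amp_inj => x; rewrite amp_unitop amp_sum big_mkcond [RHS]big_mkcond.
  apply: eq_bigr => k _; rewrite !amp_ket.
  case: (x k =P i) => [xk|xk]; case: (xl k =P j) => [xlk|xlk] //.
  - congr (_%:R); congr nat_of_bool.
    by apply/eqP/eqP => [<-|->]; rewrite upd_upd -?xk -?xlk upd_id.
  - by case: eqP => // xE; case: xlk; rewrite -xE upd_at.
  - by case: eqP => // xE; case: xk; rewrite xE upd_at.
rewrite mulmx_sumr big1 // => k /eqP xlk; rewrite /c_sym -mulmxA.
have [|l [xll cl]] := box_above sum_lam xlP (i := i) (k := k).
  by rewrite xlk dom // ltnW.
have lk : l != k by apply: contraTneq ij => lk; rewrite -xll lk xlk ltnn.
rewrite (b_sym_ket0 lk) ?mulmx0 //.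
by rewrite upd_at upd_ne.
Qed.

Lemma contentproj_young_vec :
  contentproj R K (fun i => lam i) *m young_vec = young_vec.
Proof.
rewrite /young_vec mulmxA equivariant_c_sym; last exact: contentproj_equivariant.
rewrite -mulmxA; congr (_ *m _); apply: amp_inj => x.
rewrite amp_contentproj amp_ket; case: eqP => [->|_]; last by case: ifP.
case: ifP => // /forallP; case => i.
by rewrite (count_rowword sum_lam xlP).
Qed.

(* A symmetrised highest-weight vector is determined by its value at [xl],
   so it is proportional to the highest-weight vector built from [c_sym]. *)
Lemma symmetrized_highest_weight v :
  (forall a b : 'I_d, (a <= b)%N -> (lam b <= lam a)%N) ->
  (forall i j : 'I_d, (i < j)%N -> unitop R K i j *m v = 0) ->
  contentproj R K (fun i => lam i) *m v = v ->
  exists c, a_sym R lam *m v = c *: young_vec.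
Proof.
move=> dom vE vC; exists (amp (a_sym R lam *m v) xl / amp young_vec xl).
set c := _ / _; apply/eqP; rewrite -subr_eq0; apply/eqP; apply: amp_inj => x.
rewrite amp0; set w := a_sym R lam *m v - _.
have wC : contentproj R K (fun i => lam i) *m w = w.
  rewrite mulmxBr -scalemxAr contentproj_young_vec mulmxA.
  by rewrite equivariant_a_sym -?mulmxA ?vC //; exact: contentproj_equivariant.
apply: (highest_weight_rigid (xl := xl) (u := amp w)) => {x} [x k l kl|i j x ij|x wx i|].
- rewrite /w /young_vec /c_sym -mulmxA scalemxAr -mulmxBr a_sym_inv //.
  exact: tperm_rowstab.
- rewrite -amp_unitop mulmxBr -scalemxAr unitop_young_vec // scaler0 subr0.
  rewrite mulmxA equivariant_a_sym; last exact: unitop_equivariant.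
  by rewrite -mulmxA vE // mulmx0 amp0.
- move: wx; rewrite -wC amp_contentproj; case: ifP => [/forallP cx _|]; last by rewrite eqxx.
  by rewrite (eqP (cx i)) (count_rowword sum_lam xlP).
- by rewrite ampB ampZ divfK ?subrr // young_vec_neq0.
Qed.

End YoungSymmetrizer.

(** * The Hermitian form and its positivity *)

Section Norm.
Variables (R : realType) (n : nat).
Implicit Types v : 'cV[R[i]]_n.

Lemma adj_mul_self v : (adj v *m v) 0 0 = \sum_a `|v a 0| ^+ 2.
Proof. by rewrite mxE; apply: eq_bigr => a _; rewrite !mxE mulrC normCK. Qed.

Lemma adj_mul_self_ge0 v : 0 <= (adj v *m v) 0 0.
Proof. by rewrite adj_mul_self sumr_ge0 // => a _; rewrite exprn_ge0. Qed.

Lemma adj_mul_self_eq0 v : (adj v *m v) 0 0 = 0 -> v = 0.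
Proof.
rewrite adj_mul_self => /eqP; rewrite psumr_eq0 => [/allP v0|a _]; last first.
  by rewrite exprn_ge0.
apply/colP => a; rewrite mxE; apply/eqP.
by have := v0 a (mem_index_enum _); rewrite expf_eq0 normr_eq0.
Qed.
Lemma Re_ge0 (z : R[i]) : 0 <= z -> 0 <= complex.Re z.
Proof. by rewrite lecE => /andP[]. Qed.

Lemma Re_sum (I : finType) (f : I -> R[i]) :
  complex.Re (\sum_a f a) = \sum_a complex.Re (f a).
Proof.
have ReD : {morph (@complex.Re R) : x y / x + y} by move=> [? ?] [? ?].
exact: (big_morph _ ReD (erefl : complex.Re 0 = 0)).
Qed.

(** The form is the squared norm of [Q *m v]. *)
Lemma projector_form_ge0 (Q : 'M[R[i]]_n) v : adj Q = Q -> Q *m Q = Q ->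
  0 <= (adj v *m Q *m v) 0 0.
Proof.
move=> aQ QQ; have -> : adj v *m Q *m v = adj (Q *m v) *m (Q *m v).
  by rewrite adjM aQ mulmxA -(mulmxA (adj v) Q Q) QQ.
exact: adj_mul_self_ge0.
Qed.

End Norm.

(** * Weights and the sl_2 relations *)

Section Weights.
Variables (R : realType) (d K : nat).
Notation C := R[i].
Notation N := (dimH d K).
Implicit Types (v w : 'cV[C]_N) (x y : word d K).

Lemma amp_unitop2 (i j : 'I_d) v x : i != j ->
  amp (unitop R K i j *m (unitop R K j i *m v)) x =
    (count_letter x i)%:R * amp v x +
    \sum_(k | x k == i) \sum_(l | x l == j) amp v (upd (upd x k j) l i).
Proof.
move=> ij; rewrite amp_unitop.
have -> : (count_letter x i)%:R * amp v x = \sum_(k | x k == i) amp v x.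
  by rewrite sumr_const mulr_natl /count_letter cardsE.
rewrite -big_split /=; apply: eq_bigr => k /eqP xk.
rewrite amp_unitop (bigD1 k) /= ?upd_at //; congr (_ + _).
  by rewrite upd_upd -xk upd_id.
apply: eq_bigl => l; have [->|lk] := eqVneq l k.
  by rewrite upd_at eqxx xk andbF (negbTE ij).
by rewrite upd_ne // andbT.
Qed.

(** This is the relation [E_ij, E_ji] = H_i - H_j: terms changing two distinct positions agree in
    both orders, and only the diagonal terms differ. *)
Lemma unitop_commutator (i j : 'I_d) v x : i != j ->
  amp (unitop R K i j *m (unitop R K j i *m v)) x =
    amp (unitop R K j i *m (unitop R K i j *m v)) x +
    ((count_letter x i)%:R - (count_letter x j)%:R) * amp v x.
Proof.
move=> ij; have ji : j != i by rewrite eq_sym.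
rewrite !amp_unitop2 //.
have -> : \sum_(k | x k == i) \sum_(l | x l == j) amp v (upd (upd x k j) l i) =
          \sum_(l | x l == j) \sum_(k | x k == i) amp v (upd (upd x l i) k j).
  rewrite exchange_big; apply: eq_bigr => l /eqP xl; apply: eq_bigr => k /eqP xk.
  by rewrite updC //; apply: contraNneq ij => kl; rewrite -xk kl xl.
ring.
Qed.

(* sl_2 theory: [F = unitop j i] satisfies |F w|^2 = (mu i - mu j) |w|^2. *)
Lemma highest_weight_dominant (mu : 'I_d -> nat) (i j : 'I_d) w :
  (i < j)%N -> (mu i < mu j)%N -> contentproj R K mu *m w = w ->
  unitop R K i j *m w = 0 -> w = 0.
Proof.
move=> ij muij wC wE; apply: adj_mul_self_eq0.
have EF : unitop R K i j *m (unitop R K j i *m w) = ((mu i)%:R - (mu j)%:R) *: w.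
  apply: amp_inj => x; rewrite unitop_commutator; last by rewrite neq_ltn ij.
  rewrite wE mulmx0 amp0 add0r ampZ.
  have := amp_contentproj mu w x; rewrite wC.
  by case: ifP => [/forallP cx _|_ ->]; rewrite ?mulr0 // !(eqP (cx _)).
have := adj_mul_self_ge0 (unitop R K j i *m w).
rewrite adjM adj_unitop -mulmxA EF -scalemxAr mxE.
have lt0 : (mu i)%:R - (mu j)%:R < 0 :> C by rewrite subr_lt0 ltr_nat.
rewrite nmulr_rge0 // => le0; apply/eqP.
by rewrite eq_le le0 adj_mul_self_ge0.
Qed.

(** The operator shifts every weight by the same amount, so it cannot mix the weight components of
    [w]. *)
Lemma unitop_contentproj (mu : 'I_d -> nat) (i j : 'I_d) w :
  unitop R K i j *m w = 0 -> unitop R K i j *m (contentproj R K mu *m w) = 0.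
Proof.
move=> wE; apply: amp_inj => x; rewrite amp_unitop amp0.
(* [c] says that [x] has weight [mu] plus one letter [i] minus one letter [j], whichever position
   [k] is updated. *)
pose c := [forall a, count_letter x a + (j == a) == mu a + (i == a)]%N.
rewrite (eq_bigr (fun k => if c then amp w (upd x k j) else 0)) => [|k /eqP xk].
  by case: c; [rewrite -amp_unitop wE amp0 | rewrite big1].
rewrite amp_contentproj; congr (if _ then _ else _); apply: eq_forallb => a.
by rewrite -(count_upd x k j) xk eqn_add2r.
Qed.

End Weights.

(** * Highest-weight vectors in the kernel of the projector *)

Section Complement.
Variables (R : realType) (d K : nat) (J : R) (P : 'M[R[i]]_(dimH d K)).
Hypothesis projP : orth_proj P (HJ d K J).
Notation C := R[i].
Notation N := (dimH d K).
Implicit Types (v w : 'cV[C]_N) (A B : 'M[C]_N) (x y : word d K).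

Lemma HJ_fixed m (B : 'M[C]_(N, m)) : (B^T <= HJ d K J)%MS -> P *m B = B.
Proof.
case: projP => PP [_ /andP[_ HP]] BH.
have /submxP[D BD] := submx_trans BH HP.
by rewrite -[B]trmxK BD /colspace trmx_mul trmxK mulmxA PP.
Qed.

(** [A] moves past [Vperm s *m c_sym R lam] to its right, where it can only shrink the column
    space. *)
Lemma HJ_equivariant A : equivariant A -> (HJ d K J *m A^T <= HJ d K J)%MS.
Proof.
move=> hA; rewrite sumsmxMr; apply/sumsmx_subP => lam lamJ.
apply: submx_trans (sumsmx_sup lam lamJ (submx_refl _)).
rewrite sumsmxMr; apply/sumsmx_subP => s _.
apply: submx_trans (sumsmx_sup s isT (submx_refl _)).
have AVc : A *m (Vperm R d s *m c_sym R lam) = Vperm R d s *m c_sym R lam *m A.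
  by rewrite mulmxA hA -mulmxA (equivariant_c_sym _ hA) mulmxA.
suff -> : colspace (Vperm R d s *m c_sym R lam) *m A^T =
          A^T *m colspace (Vperm R d s *m c_sym R lam) by exact: submxMl.
by rewrite /colspace -[LHS]trmx_mul AVc trmx_mul.
Qed.

(** Permutation operators need not commute with one another, but they permute the summands of each
    isotypic component. *)
Lemma HJ_Vperm s : (HJ d K J *m (Vperm R d s)^T <= HJ d K J)%MS.
Proof.
rewrite sumsmxMr; apply/sumsmx_subP => lam lamJ.
apply: submx_trans (sumsmx_sup lam lamJ (submx_refl _)).
rewrite sumsmxMr; apply/sumsmx_subP => t _.
apply: submx_trans (sumsmx_sup (t * s)%g isT (submx_refl _)).
by rewrite /colspace -[X in (X <= _)%MS]trmx_mul mulmxA VpermM.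
Qed.

(** Since [P] is self-adjoint, its kernel is the orthogonal complement of [HJ], which [A] preserves
    as soon as [adj A] preserves [HJ]. *)
Lemma kerP_stable A w :
  (HJ d K J *m (adj A)^T <= HJ d K J)%MS -> P *m w = 0 -> P *m (A *m w) = 0.
Proof.
case: projP => PP [aP /andP[PH _]] hA Pw.
have : P *m (adj A *m P) = adj A *m P.
  by apply: HJ_fixed; rewrite trmx_mul (submx_trans (submxMr _ PH)).
move/(congr1 (@adj _ _ _)); rewrite !adjM !aP adjK => PAP.
by rewrite mulmxA -PAP -mulmxA Pw mulmx0.
Qed.

Lemma kerP_Vperm s w : P *m w = 0 -> P *m (Vperm R d s *m w) = 0.
Proof. by apply: kerP_stable; rewrite adj_Vperm HJ_Vperm. Qed.

(** As in [lam_last], the sum merely selects the last letter; the inequality negates the one that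
    defines [HJ]. *)
Definition bad x : bool :=
  (\sum_(i < d | val i == d.-1) count_letter x i)%:R < K%:R / d%:R - J.

Lemma highest_weight_vanish w :
  P *m w = 0 -> (forall i j : 'I_d, (i < j)%N -> unitop R K i j *m w = 0) ->
  (forall x, bad x -> amp w x = 0) -> w = 0.
Proof.
move=> Pw wE wbad; apply: amp_inj => x0; rewrite amp0.
have [/wbad//|good] := boolP (bad x0).
(* The content of [x0], read as row lengths, is the candidate diagram. *)
pose lam : {ffun 'I_d -> 'I_K.+1} := [ffun i => inord (count_letter x0 i)].
have lamE i : lam i = count_letter x0 i :> nat.
  by rewrite ffunE inordK // ltnS count_letter_le.
pose mu i : nat := lam i.
pose w' := contentproj R K mu *m w.
have -> : amp w x0 = amp w' x0.
  rewrite amp_contentproj; case: ifP => // /forallP; case => i.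
  by rewrite /mu lamE.
have w'C : contentproj R K mu *m w' = w'.
  by apply: amp_inj => x; rewrite amp_contentproj /w' amp_contentproj; case: ifP => [->|].
have w'E (i j : 'I_d) : (i < j)%N -> unitop R K i j *m w' = 0.
  by move=> ij; apply: unitop_contentproj; exact: wE.
have Pw' : P *m w' = 0.
  apply: kerP_stable Pw; rewrite adj_contentproj; apply: HJ_equivariant.
  exact: contentproj_equivariant.
have [dom|] := pselect (forall a b : 'I_d, (a <= b)%N -> (lam b <= lam a)%N); last first.
  (* A content that is not dominant carries no nonzero highest-weight vector. *)
  move=> /existsNP [a] /existsNP [b] /not_implyP [le_ab /negP].
  rewrite -ltnNge => lt_ab.
  have {le_ab}lt : (a < b)%N.
    by rewrite ltn_neqAle le_ab andbT; apply: contraTneq lt_ab => /val_inj ->; rewrite ltnn.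
  by rewrite (highest_weight_dominant lt lt_ab w'C (w'E _ _ lt)) amp0.
have sum_lam : (\sum_(i < d) (lam i : nat))%N = K.
  by rewrite -[RHS](sum_count_letter1 x0); apply: eq_bigr => i _; rewrite lamE.
have [xl xlP] := exists_rowword sum_lam.
(* Permuting positions moves the evaluation point to [xl]. *)
have [s x0E] : exists s, x0 = wperm xl s.
  by apply: same_content_perm => i; rewrite (count_rowword sum_lam xlP) lamE.
have lamJ : young lam && (K%:R / d%:R - J <= (lam_last lam)%:R).
  rewrite /young sum_lam eqxx andbT; apply/andP; split.
    by apply/'forall_forallP => i j; apply/implyP; exact: dom.
  rewrite leNgt; apply: contra good.
  by rewrite /bad /lam_last; under eq_bigr do rewrite lamE.
have Ph : P *m young_vec R lam xl = young_vec R lam xl.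
  apply: HJ_fixed; apply: submx_trans (sumsmx_sup lam lamJ (submx_refl _)).
  apply: submx_trans (sumsmx_sup 1%g isT (submx_refl _)).
  by rewrite /colspace Vperm1 mul1mx /young_vec trmx_mul submxMl.
have [c aE] : exists c, a_sym R lam *m (Vperm R d s *m w') = c *: young_vec R lam xl.
  apply: symmetrized_highest_weight => //.
    by move=> i j ij; rewrite mulmxA unitop_equivariant -mulmxA w'E // mulmx0.
  by rewrite mulmxA contentproj_equivariant -mulmxA w'C.
have Pa : P *m (a_sym R lam *m (Vperm R d s *m w')) = 0.
  rewrite mulmx_suml mulmx_sumr big1 // => p _.
  by do 2 apply: kerP_Vperm.
(* The vector is in the kernel of [P] and, as a multiple of [young_vec], also fixed by [P]. *)
have a0 : a_sym R lam *m (Vperm R d s *m w') = 0.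
  by rewrite aE -Ph scalemxAr -aE.
(* At [xl] symmetrisation only multiplies the amplitude by the nonzero order of the row
   stabiliser. *)
have := amp_a_sym_word xlP (Vperm R d s *m w').
rewrite a0 amp0 amp_Vperm -x0E => /esym/eqP.
by rewrite mulf_eq0 (negbTE (card_rowstab_neq0 _ _)) => /eqP.
Qed.

End Complement.

(** * The rank of the complement *)

Section PairCounts.
Variables d K : nat.
Implicit Types (x y z : word d K) (k : 'I_K).

Definition wle x y := [forall k, (x k <= y k)%N].
Definition upper_pair := {p : 'I_d * 'I_d | (p.1 < p.2)%N}.
Definition pair_count x y (p : 'I_d * 'I_d) : nat :=
  #|[set k | (x k, y k) == p]|.
(** At most [K] positions carry a given pair, so [inord] never falls back on its default. Recording
    only pairs [a < b] yields the exponent [d(d-1)/2]. *)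
Definition upper_count x y : {ffun upper_pair -> 'I_K.+1} :=
  [ffun p => inord (pair_count x y (val p))].

Lemma pair_count_lt x y p : (pair_count x y p < K.+1)%N.
Proof. by rewrite ltnS -[X in (_ <= X)%N]card_ord max_card. Qed.

Lemma pair_count_gt x y (a b : 'I_d) : wle x y -> (b < a)%N -> pair_count x y (a, b) = 0%N.
Proof.
move=> /forallP xy ba; apply/eqP; rewrite cards_eq0; apply/eqP/setP => k.
rewrite !inE; apply/negP => /eqP [xk yk]; have := xy k.
by rewrite xk yk leqNgt ba.
Qed.

Lemma sum_pair_count x y (a : 'I_d) : (\sum_b pair_count x y (a, b) = count_letter x a)%N.
Proof.
rewrite /count_letter -sum1dep_card (partition_big y predT) //=.
apply: eq_bigr => b _; rewrite sum1dep_card.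
by apply: eq_card => k; rewrite !inE xpair_eqE.
Qed.

(* Diagonal pair counts are recovered from the row content. *)
Lemma upper_count_perm x y z : wle x y -> wle x z ->
  upper_count x y = upper_count x z -> exists s, wperm x s = x /\ wperm y s = z.
Proof.
move=> xy xz eq_u.
have eq_lt (a b : 'I_d) : (a < b)%N -> pair_count x y (a, b) = pair_count x z (a, b).
  move=> ab; have := congr1 (fun u : {ffun _ -> _} => u (exist _ (a, b) ab)) eq_u.
  rewrite !ffunE /= => /(congr1 (@nat_of_ord _)).
  by rewrite !inordK // pair_count_lt.
have eq_ne (a b : 'I_d) : b != a -> pair_count x y (a, b) = pair_count x z (a, b).
  rewrite -(inj_eq val_inj) neq_ltn => /orP[ba|]; last exact: eq_lt.
  by rewrite !pair_count_gt.
have [|s sP] := @perm_of_fibers K _ (fun k => (x k, y k)) (fun k => (x k, z k)).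
  case=> a b; have [->|ne] := eqVneq b a; last exact: eq_ne.
  have := sum_pair_count x z a; rewrite -(sum_pair_count x y a).
  rewrite (bigD1 a) //= [in RHS](bigD1 a) //=.
  by under eq_bigr do rewrite -eq_ne //; move/addIn/esym.
by exists s; split; apply/ffunP => k; rewrite ffunE; case: (sP k).
Qed.

Lemma card_upper_pair : #|{: upper_pair}| = ((d * (d - 1)) %/ 2)%N.
Proof.
rewrite card_sig subn1 divn2 -bin2 -triangular_sum.
rewrite -sum1_card (eq_bigl (fun p : 'I_d * 'I_d => (p.1 < p.2)%N)) //.
rewrite -(pair_big_dep xpredT (fun a b : 'I_d => (a < b)%N) (fun _ _ => 1%N)) /=.
rewrite (exchange_big_dep xpredT) //= big_mkord; apply: eq_bigr => b _.
by rewrite sum1dep_card card_ord_lt // ltnW.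
Qed.

End PairCounts.

(** * Test functionals that separate the kernel of the projector *)

Section RankBound.
Variables (R : realType) (d K : nat) (J : R) (P : 'M[R[i]]_(dimH d K)).
Hypothesis projP : orth_proj P (HJ d K J).
Notation C := R[i].
Notation N := (dimH d K).
Implicit Types (v w : 'cV[C]_N) (A B : 'M[C]_N) (x y z : word d K).

(* The Borel subalgebra of the commutant of the symmetric group action. *)
Definition borel A := equivariant A /\ forall x y, entry A x y != 0 -> wle x y.

Lemma borel1 : borel 1%:M.
Proof.
split=> [|x y]; first exact: equivariant1.
rewrite entryE mul1mx amp_ket; case: (x =P y) => [-> _|_]; last by rewrite eqxx.
exact/forallP.
Qed.

(** A nonzero entry of the matrix-unit operator at [(z, y)] means that [y] arises from [z] by
    changing one letter [a] to [b], so [z] lies below [y]. *)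
Lemma borel_unitop A (a b : 'I_d) : (a < b)%N -> borel A ->
  borel (A *m unitop R K a b).
Proof.
move=> ab [eqA leA]; split=> [|x y].
  by apply: equivariantM => //; exact: unitop_equivariant.
rewrite entryE -mulmxA ampM => nz.
have [z nz_z] : exists z, entry A x z * amp (unitop R K a b *m ket R y) z != 0.
  apply/existsP; apply: contraNT nz => /existsPn all0.
  by rewrite big1 // => z _; apply/eqP; have := all0 z; rewrite negbK.
have [Axz nz2] : entry A x z != 0 /\ amp (unitop R K a b *m ket R y) z != 0.
  by apply/andP; rewrite -negb_or -mulf_eq0.
apply/forallP => k; apply: (leq_trans (forallP (leA _ _ Axz) k)).
have [l zl yE] : exists2 l, z l = a & upd z l b = y.
  apply/exists2P; apply: contraPP nz2 => none.
  rewrite amp_unitop big1 ?eqxx // => l /eqP zl; rewrite amp_ket.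
  by case: eqP => // zy; case: none; exists l.
rewrite -yE; have [->|kl] := eqVneq k l; last by rewrite upd_ne.
by rewrite upd_at zl ltnW.
Qed.

Definition bad_word := {x : word d K | bad J x}.

(** Each row is the indicator of the words above a bad word [x] with prescribed pair counts relative
    to [x]; the number of rows will bound the rank. *)
Definition testmx : 'M[C]_(#|{: {ffun upper_pair d -> 'I_K.+1} * bad_word}|, N) :=
  \matrix_(a, b) (let nx := enum_val a in let x := val nx.2 in let z := enum_val b in
     (wle x z && (upper_count x z == nx.1))%:R).

(** By [upper_count_perm] and equivariance, row [x] of [A] is constant on each set tested by
    [testmx] and vanishes elsewhere. *)
Lemma testmx_borel w A x : testmx *m w = 0 -> borel A -> bad J x ->
  amp (A *m w) x = 0.
Proof.
move=> Tw [eqA leA] badx.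
have Tw0 n : \sum_(z | wle x z && (upper_count x z == n)) amp w z = 0.
  have := congr1 (fun u : 'cV_ _ => u (enum_rank (n, exist _ x badx)) 0) Tw.
  rewrite !mxE (reindex_onto (@enum_rank (word d K)) enum_val) /=; last first.
    by move=> a _; rewrite enum_valK.
  move=> T0; rewrite -[RHS]T0 [LHS]big_mkcond; apply: eq_big => [z|z _].
    by rewrite enum_rankK eqxx.
  by rewrite mxE !enum_rankK /=; case: ifP; rewrite ?mul1r ?mul0r.
rewrite ampM (bigID (wle x)) /= [X in _ + X]big1 ?addr0 => [|z nle]; last first.
  have [->|/leA] := eqVneq (entry A x z) 0; first by rewrite mul0r.
  by rewrite (negbTE nle).
rewrite (partition_big (upper_count x) xpredT) //= big1 // => n _.
have [[z0 /andP[le0 /eqP n0]]|none] := pselect (exists z, wle x z && (upper_count x z == n)).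
  rewrite (eq_bigr (fun z => entry A x z0 * amp w z)).
    by rewrite -mulr_sumr Tw0 mulr0.
  move=> z /andP[lez /eqP nz]; congr (_ * _).
  have [|s [xs z0s]] := @upper_count_perm _ _ x z0 z le0 lez; first by rewrite n0.
  by rewrite -{1}xs -z0s equivariant_entry.
by rewrite big1 // => z hz; case: none; exists z.
Qed.

(* The operators [unitop a b] with [a < b] lower the sum of the letters, so a
   minimal counterexample would be a highest-weight vector. *)
Lemma testmx_inj w : P *m w = 0 -> testmx *m w = 0 -> w = 0.
Proof.
move=> Pw Tw.
(* Only vanishing for the whole Borel algebra is kept, a form that [unitop a b *m w] inherits. *)
have Yw A x : borel A -> bad J x -> amp (A *m w) x = 0 by exact: testmx_borel.
move: w {Tw} Pw Yw.
suff main n w : P *m w = 0 ->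
    (forall A x, borel A -> bad J x -> amp (A *m w) x = 0) ->
    (forall x, amp w x != 0 -> (\sum_k (x k : nat) < n)%N) -> w = 0.
  (* Each of the [K] letters is below [d], so all letter sums are below [(K * d).+1]. *)
  move=> w Pw Yw; apply: (main (K * d).+1%N w Pw Yw) => x _.
  rewrite ltnS -[X in (_ <= X * _)%N]card_ord -sum_nat_const leq_sum // => k _.
  exact: ltnW.
elim: n w => [|n IHn] w Pw Yw hw.
  by apply: amp_inj => x; rewrite amp0; apply/eqP; apply/negPn/negP => /hw.
apply: (highest_weight_vanish projP Pw) => [a b ab|x badx]; last first.
  by rewrite -[w]mul1mx Yw //; exact: borel1.
apply: IHn => [|A x bA badx|x].
- apply: (kerP_stable projP) Pw.
  by rewrite adj_unitop; apply: HJ_equivariant; exact: unitop_equivariant.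
- by rewrite mulmxA Yw //; exact: borel_unitop.
- move=> nz; have [k /eqP xk nz2] : exists2 k, x k == a & amp w (upd x k b) != 0.
    apply/exists2P; apply: contraPP nz => none.
    rewrite amp_unitop big1 ?eqxx // => k xk; apply/eqP/negPn/negP => nz2.
    by case: none; exists k.
  have := hw _ nz2; have := sum_upd x k b (@nat_of_ord d); rewrite xk.
  by move: ab; lia.
Qed.

(** In a full-rank factorisation [Q = c *m r], idempotence forces [r *m c] to be the identity of
    size the rank; the trace is cyclic. *)
Lemma mxtrace_idem n (Q : 'M[C]_n) : Q *m Q = Q -> \tr Q = (\rank Q)%:R.
Proof.
move=> QQ; have := mulmx_base Q; set c := col_base Q; set r := row_base Q => crQ.
have -> : \tr Q = \tr (r *m c) by rewrite mxtrace_mulC crQ.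
suff -> : r *m c = 1%:M by rewrite mxtrace1.
apply: (row_free_inj (row_base_free Q)); apply: (row_full_inj (col_base_full Q)).
by rewrite /= mul1mx -/c -/r -(mulmxA r c r) crQ mulmxA crQ QQ.
Qed.

(** The range of [1 - P] lies in the kernel of [P], where [testmx] is injective. The transposes pass
    from columns to row spaces. *)
Lemma mxrank_complement_le :
  (\rank (1%:M - P)%R <=
     K.+1 ^ ((d * (d - 1)) %/ 2) * #|[set x : word d K | bad J x]|)%N.
Proof.
have [PP _] := projP; set Q := 1%:M - P.
have PQ : P *m Q = 0 by rewrite mulmxBr PP mulmx1 subrr.
rewrite -mxrank_tr -(mxrank_mul_ker Q^T testmx^T).
have -> : (Q^T :&: kermx testmx^T)%MS = 0.
  apply/eqP/rowV0P => u; rewrite sub_capmx => /andP[/submxP[D uD] /sub_kermxP uT].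
  apply: trmx_inj; rewrite trmx0; apply: testmx_inj; apply: trmx_inj.
    by rewrite trmx_mul trmxK trmx0 uD -mulmxA -trmx_mul PQ trmx0 mulmx0.
  by rewrite trmx_mul trmxK uT trmx0.
rewrite mxrank0 addn0 (leq_trans (rank_leq_col _)) //.
rewrite card_prod card_ffun card_ord card_upper_pair leq_mul2l.
by rewrite card_sig cardsE leqnn orbT.
Qed.

Lemma complement_idem : (1%:M - P) *m (1%:M - P) = 1%:M - P.
Proof.
have [PP _] := projP.
by rewrite mulmxBl mul1mx mulmxBr mulmx1 PP subrr subr0.
Qed.

End RankBound.

(** * Hoeffding's inequality *)

Section Hoeffding.
Variable R : realType.
Implicit Types (p s u : R).

Lemma derive_ge0_le (f f' : R -> R) u :
  (forall x, is_derive x (1 : R) f (f' x)) -> (forall x, 0 < x -> 0 <= f' x) ->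
  0 <= u -> f 0 <= f u.
Proof.
move=> df f'0; rewrite le_eqVlt => /predU1P[<-//|u0].
have [|c c0u] := MVT u0 (fun x _ => df x).
  apply: derivable_within_continuous => x _; exact: ex_derive.
rewrite in_itv /= in c0u; case/andP: c0u => c0 _.
rewrite subr0 -subr_ge0 => ->; rewrite mulr_ge0 ?f'0 // ltW //.
Qed.

(** This is tanh(u/2) <= u/2. The difference has derivative e^x (e^(-x) - 1 + x) / 2, nonnegative by
    e^y >= 1 + y. *)
Lemma expR_sub1_le u : 0 <= u -> expR u - 1 <= u / 2 * (expR u + 1).
Proof.
move=> u0; rewrite -subr_ge0.
pose f x : R := x / 2 * (expR x + 1) - (expR x - 1).
suff : f 0 <= f u by rewrite /f mul0r mul0r expR0 subrr subr0.
apply: (@derive_ge0_le f (fun x => (expR x + 1) / 2 + x / 2 * expR x - expR x)) => //.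
  move=> x; rewrite /f; apply: is_derive_eq.
  by rewrite /GRing.scale /=; ring.
move=> x x0; have := expR_ge1Dx (- x).
have ex0 := expR_gt0 x; have enx0 := expR_gt0 (- x).
have e1 : expR x * expR (- x) = 1 by rewrite -expRD subrr expR0.
nra.
Qed.

(* With [E = expR (x / 2)], monotonicity of the quotient of both sides reduces
   to [(1 - p) E^2 + p >= p (1 - p) (E + 1)^2] and [expR_sub1_le]. *)
Lemma bernoulli_mgf_le p s : 0 <= p <= 1 -> 0 <= s ->
  1 - p + p * expR (- s) <= expR (s ^+ 2 / 8 - p * s).
Proof.
move=> /andP[p0 p1] s0.
pose g x : R := expR (p * x - x ^+ 2 / 8).
pose f x : R := - ((1 - p + p * expR (- x)) * g x).
have : f 0 <= f s.
  apply: (@derive_ge0_le f (fun x => g x *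
    (p * expR (- x) - (p - x / 4) * (1 - p + p * expR (- x))))) => //.
    move=> x; rewrite /f /g; apply: is_derive_eq.
    by rewrite /GRing.scale /=; field.
  move=> x x0; rewrite mulr_ge0 // ?expR_ge0 //.
  pose E := expR (x / 2).
  have E0 : 0 < E by exact: expR_gt0.
  have EE : expR (- x) * (E * E) = 1.
    by rewrite /E -!expRD (_ : _ + _ = 0) ?expR0 //; field.
  have hE : E - 1 <= x / 4 * (E + 1).
    have := @expR_sub1_le (x / 2); rewrite -/E => /(_ _)/le_trans; apply.
      by rewrite divr_ge0 // ltW.
    by rewrite (_ : x / 2 / 2 = x / 4) //; field.
  have ex0 := expR_gt0 (- x).
  (* Multiplying by [E * E] removes [expR (- x)] and leaves nonnegative multiples of a square and of
     the slack in [hE]. *)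
  rewrite -(pmulr_lge0 _ (mulr_gt0 E0 E0)).
  have -> : (p * expR (- x) - (p - x / 4) * (1 - p + p * expR (- x))) * (E * E) =
    x / 4 * ((1 - p) * E - p) ^+ 2 + p * (1 - p) * (E + 1) * (x / 4 * (E + 1) - (E - 1)).
    transitivity (p * (expR (- x) * (E * E)) - (p - x / 4) * ((1 - p) * (E * E) + p * (expR (- x) * (E * E)))).
      by ring.
    by rewrite EE; field.
  rewrite addr_ge0 // mulr_ge0 ?sqr_ge0 ?subr_ge0 ?divr_ge0 ?(ltW x0) //.
  by rewrite !mulr_ge0 ?subr_ge0 ?addr_ge0 // ltW.
rewrite /f /g expr0n mulr0 mul0r subr0 oppr0 expR0 !mulr1 subrK lerN2 => le1.
rewrite -(ler_pM2r (expR_gt0 (p * s - s ^+ 2 / 8))) (le_trans le1) //.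
by rewrite -expRD (_ : _ + _ = 0) ?expR0 //; ring.
Qed.

End Hoeffding.

(** * Counting bad words *)

Section Tail.
Variables (R : realType) (d K : nat) (J : R).
Hypotheses (d2 : (2 <= d)%N) (K1 : (1 <= K)%N) (J0 : 0 <= J).
Implicit Types x : word d K.

Let last_letter (i : 'I_d) : bool := val i == d.-1.

(** Chernoff's method for a uniform word, whose positions independently carry the last letter with
    probability [1 / d]. *)
Lemma card_bad_lt :
  #|[set x : word d K | bad J x]|%:R < d%:R ^+ K * expR (- (2 * J ^+ 2) / K%:R).
Proof.
have d0 : 0 < d%:R :> R by rewrite ltr0n; case: d d2.
have K0 : 0 < K%:R :> R by rewrite ltr0n.
have dd : (d.-1 < d)%N by case: d d2.
pose c x := (\sum_k (last_letter (x k) : nat))%N.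
have badE x : bad J x = ((c x)%:R < K%:R / d%:R - J).
  congr (_%:R < _); rewrite /c (sum_count_letter x (fun i => last_letter i : nat)).
  by rewrite big_mkcond; apply: eq_bigr => i _; case: ifP; rewrite /last_letter => ->; rewrite ?muln1 ?muln0.
(* This value minimises [K * s^2 / 8 - s * J]; the minimum is [- 2 * J^2 / K]. *)
pose s : R := 4 * J / K%:R.
have s0 : 0 <= s by rewrite !(mulr_ge0, invr_ge0) // ltW.
pose a : R := K%:R / d%:R - J.
have chernoff : #|[set x : word d K | bad J x]|%:R <
    \sum_(x : word d K) expR (s * (a - (c x)%:R)).
  rewrite -sum1dep_card natr_sum big_mkcond /=.
  (* The constant word on the last letter is never bad, and its positive exponential makes the bound
     strict. *)
  pose x0 : word d K := [ffun=> Ordinal dd].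
  rewrite (bigD1 x0) //= [ltRHS](bigD1 x0) //=; apply: ltr_leD.
    suff -> : bad J x0 = false by exact: expR_gt0.
    rewrite badE (_ : c x0 = K); last first.
      rewrite /c (eq_bigr (fun=> 1%N)) ?sum1_card ?card_ord // => k _.
      by rewrite ffunE /last_letter /= eqxx.
    apply/negbTE; rewrite -leNgt lerBlDr (le_trans (_ : _ <= K%:R)) ?lerDl //.
    by rewrite ler_pdivrMr // ler_peMr ?ler1n // ?ltW //; case: d d2.
  apply: ler_sum => x _; case: ifP => [|_]; last exact: expR_ge0.
  rewrite badE => cx; rewrite (le_trans _ (expR_ge1Dx _)) // lerDl mulr_ge0 //.
  by rewrite subr_ge0 ltW.
apply: (lt_le_trans chernoff).
(* The sum factorises over positions: the last letter contributes [expR (- s)], each other letter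
   1. *)
have -> : \sum_(x : word d K) expR (s * (a - (c x)%:R)) =
    expR (s * a) * ((d%:R - 1) + expR (- s)) ^+ K.
  under eq_bigr => x _.
    rewrite mulrBr expRD /c natr_sum mulr_sumr -sumrN expR_sum.
    over.
  rewrite -mulr_sumr; congr (_ * _).
  rewrite -(bigA_distr_bigA (fun (k : 'I_K) (i : 'I_d) => expR (- (s * (last_letter i)%:R)))) /=.
  rewrite prodr_const card_ord; congr (_ ^+ _).
  rewrite (bigD1 (Ordinal dd)) //= /last_letter eqxx mulr1 addrC; congr (_ + _).
  rewrite (eq_bigr (fun=> 1)) => [|i]; last first.
    by rewrite -(inj_eq val_inj) /= => /negbTE ->; rewrite mulr0 oppr0 expR0.
  rewrite sumr_const (_ : #|_| = d.-1); last first.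
    by rewrite cardC1 card_ord.
  by rewrite -subn1 natrB //; case: d d2.
pose p : R := d%:R^-1.
have p01 : 0 <= p <= 1.
  by rewrite invr_ge0 ltW //= invf_le1 // ler1n; case: d d2.
have := bernoulli_mgf_le p01 s0.
have -> : d%:R - 1 + expR (- s) = d%:R * (1 - p + p * expR (- s)) :> R.
  by rewrite /p; field; rewrite gt_eqF.
move=> le; rewrite exprMn mulrCA ler_pM2l ?exprn_gt0 //.
have q0 : 0 <= 1 - p + p * expR (- s).
  by case/andP: p01 => p0 p1; rewrite addr_ge0 ?subr_ge0 // mulr_ge0 ?expR_ge0.
apply: (@le_trans _ _ (expR (s * a) * expR (s ^+ 2 / 8 - p * s) ^+ K)).
  by rewrite ler_pM2l ?expR_gt0 // lerXn2r // nnegrE ?expR_ge0.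
rewrite -expRM_natr -expRD ler_expR le_eqVlt; apply/orP; left; apply/eqP.
by rewrite /s /a /p; field; rewrite !gt_eqF.
Qed.

End Tail.

(** * Random unit vectors *)

Section ComplexMeasurable.
Variables (R : realType) (dT : measure_display) (T : measurableType dT).
Notation C := R[i].
Implicit Types f g : T -> C.

(** Real and imaginary parts are separated to match the measurability assumed of [Psi]. *)
Definition cmeasurable f := measurable_fun setT (fun w => complex.Re (f w)) /\
  measurable_fun setT (fun w => complex.Im (f w)).

Lemma cmeasurable_cst (c : C) : cmeasurable (fun=> c).
Proof. by split; exact: measurable_cst. Qed.

Lemma cmeasurableD f g : cmeasurable f -> cmeasurable g ->
  cmeasurable (fun w => f w + g w).
Proof.
move=> [fr fi] [gr gi]; split.
  rewrite (_ : (fun _ => _) = (fun w => complex.Re (f w) + complex.Re (g w))).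
    exact: measurable_funD.
  by apply/funext => w; case: (f w) (g w) => ? ? [? ?].
rewrite (_ : (fun _ => _) = (fun w => complex.Im (f w) + complex.Im (g w))).
  exact: measurable_funD.
by apply/funext => w; case: (f w) (g w) => ? ? [? ?].
Qed.

Lemma cmeasurableM f g : cmeasurable f -> cmeasurable g ->
  cmeasurable (fun w => f w * g w).
Proof.
move=> [fr fi] [gr gi]; split.
  rewrite (_ : (fun _ => _) = (fun w => complex.Re (f w) * complex.Re (g w) -
                                        complex.Im (f w) * complex.Im (g w))).
    by apply: measurable_funB; exact: measurable_funM.
  by apply/funext => w; case: (f w) (g w) => ? ? [? ?].
rewrite (_ : (fun _ => _) = (fun w => complex.Re (f w) * complex.Im (g w) +
                                      complex.Im (f w) * complex.Re (g w))).
  by apply: measurable_funD; exact: measurable_funM.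
by apply/funext => w; case: (f w) (g w) => ? ? [? ?].
Qed.

Lemma cmeasurable_conj f : cmeasurable f -> cmeasurable (fun w => (f w)^*).
Proof.
move=> [fr fi]; split.
  rewrite (_ : (fun _ => _) = (fun w => complex.Re (f w))) //.
  by apply/funext => w; case: (f w).
rewrite (_ : (fun _ => _) = (fun w => - complex.Im (f w))).
  exact: measurableT_comp.
by apply/funext => w; case: (f w).
Qed.

Lemma cmeasurable_sum (I : Type) (r : seq I) (f : I -> T -> C) :
  (forall a, cmeasurable (f a)) -> cmeasurable (fun w => \sum_(a <- r) f a w).
Proof.
move=> mf; elim: r => [|a r IHr].
  by under eq_fun do rewrite big_nil; exact: cmeasurable_cst.
by under eq_fun do rewrite big_cons; exact: cmeasurableD.
Qed.

Definition mxmeasurable m n (M : T -> 'M[C]_(m, n)) :=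
  forall a b, cmeasurable (fun w => M w a b).

Lemma mxmeasurable_cst m n (M : 'M[C]_(m, n)) : mxmeasurable (fun=> M).
Proof. by move=> a b; exact: cmeasurable_cst. Qed.

Lemma mxmeasurableM m n p (M : T -> 'M[C]_(m, n)) (M' : T -> 'M[C]_(n, p)) :
  mxmeasurable M -> mxmeasurable M' -> mxmeasurable (fun w => M w *m M' w).
Proof.
move=> mM mM' a b; under eq_fun do rewrite mxE.
by apply: cmeasurable_sum => c; exact: cmeasurableM.
Qed.

Lemma mxmeasurable_adj m n (M : T -> 'M[C]_(m, n)) :
  mxmeasurable M -> mxmeasurable (fun w => adj (M w)).
Proof.
by move=> mM a b; under eq_fun do rewrite !mxE; exact: cmeasurable_conj.
Qed.

Lemma mxmeasurableD m n (M M' : T -> 'M[C]_(m, n)) :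
  mxmeasurable M -> mxmeasurable M' -> mxmeasurable (fun w => M w + M' w).
Proof.
by move=> mM mM' a b; under eq_fun do rewrite mxE; exact: cmeasurableD.
Qed.

Lemma mxmeasurableZ m n (f : T -> C) (M : T -> 'M[C]_(m, n)) :
  cmeasurable f -> mxmeasurable M -> mxmeasurable (fun w => f w *: M w).
Proof.
by move=> mf mM a b; under eq_fun do rewrite mxE; exact: cmeasurableM.
Qed.

Lemma cmeasurable_tr n (M : T -> 'M[C]_n) :
  mxmeasurable M -> cmeasurable (fun w => \tr (M w)).
Proof. by move=> mM; apply: cmeasurable_sum => a; exact: mM. Qed.

End ComplexMeasurable.

(** * Averaging over signed permutation matrices *)

Section Twirl.
Variables (R : realType) (n : nat).
Notation C := R[i].
Notation signed_perm := ({ffun 'I_n -> bool} * 'S_n)%type.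
Implicit Type Q : 'M[C]_n.

Definition signed_perm_mx (g : signed_perm) : 'M[C]_n :=
  \matrix_(i, j) ((-1) ^+ g.1 i * (i == g.2 j)%:R).

Lemma signed_perm_conj Q g i j :
  (adj (signed_perm_mx g) *m Q *m signed_perm_mx g) i j =
    (-1) ^+ g.1 (g.2 i) * (-1) ^+ g.1 (g.2 j) * Q (g.2 i) (g.2 j).
Proof.
rewrite mxE (bigD1 (g.2 j)) //= big1 ?addr0 => [|b bj]; last first.
  by rewrite [signed_perm_mx g b j]mxE (negbTE bj) !mulr0.
rewrite mxE (bigD1 (g.2 i)) //= big1 ?addr0 => [|a ai]; last first.
  by rewrite !mxE (negbTE ai) mulr0 rmorph0 mul0r.
rewrite !mxE !eqxx !mulr1 rmorphXn rmorphN rmorph1.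
by rewrite mulrAC.
Qed.

Lemma signed_perm_unitary g : adj (signed_perm_mx g) *m signed_perm_mx g = 1%:M.
Proof.
apply/matrixP => i j; rewrite -[adj _]mulmx1 signed_perm_conj !mxE (inj_eq perm_inj).
by case: eqP => [->|]; rewrite ?mulr0 // mulr1 -expr2 sqrr_sign.
Qed.

(* Averaging over signs kills the off-diagonal entries and averaging over
   permutations equalises the diagonal ones. *)
Lemma signed_perm_twirl Q :
  \sum_g adj (signed_perm_mx g) *m Q *m signed_perm_mx g =
    (#|{: signed_perm}|%:R * \tr Q / n%:R)%:M.
Proof.
(* In dimension zero there is no entry to compare; otherwise [n] can be divided by. *)
have [n0|n0] := posnP n.
  by apply/matrixP => -[a lta]; exfalso; move: lta; rewrite n0.
apply/matrixP => i j; rewrite summxE.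
under eq_bigr do rewrite signed_perm_conj.
rewrite -(pair_big xpredT xpredT (fun (e : {ffun 'I_n -> bool}) (s : 'S_n) =>
  (-1) ^+ e (s i) * (-1) ^+ e (s j) * Q (s i) (s j))) /= exchange_big /=.
rewrite !mxE; have [<-{j}|ij] := eqVneq i j; last first.
  rewrite mulr0n big1 // => s _.
  (* Flipping the sign at [s i] alone is an involution that negates the sum. *)
  pose flip (e : {ffun 'I_n -> bool}) := [ffun a => e a (+) (a == s i)].
  have flipK : involutive flip by move=> e; apply/ffunP => a; rewrite !ffunE addbK.
  set S := \sum_e _; suff SN : S = - S.
    by move/eqP: SN; rewrite -addr_eq0 -mulr2n mulrn_eq0 => /eqP.
  rewrite {1}/S (reindex_inj (inv_inj flipK)) -sumrN; apply: eq_bigr => e _.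
  rewrite !ffunE eqxx (inj_eq perm_inj) eq_sym (negbTE ij) addbT addbF signrN.
  by rewrite !mulNr.
have sumE k : \sum_(s : 'S_n) Q (s k) (s k) = \sum_(s : 'S_n) Q (s i) (s i).
  rewrite (reindex_inj (mulgI (tperm i k))) /=; apply: eq_bigr => s _.
  by rewrite permM tpermR.
have : n%:R * \sum_(s : 'S_n) Q (s i) (s i) = #|{: 'S_n}|%:R * \tr Q.
  have -> : n%:R * \sum_(s : 'S_n) Q (s i) (s i) = \sum_k \sum_(s : 'S_n) Q (s k) (s k).
    by rewrite (eq_bigr _ (fun k _ => sumE k)) sumr_const card_ord mulr_natl.
  rewrite exchange_big /= (eq_bigr (fun=> \tr Q)) => [|s _]; last first.
    by rewrite /mxtrace [RHS](reindex_inj (@perm_inj _ s)).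
  by rewrite sumr_const mulr_natl.
move=> nS; rewrite mulr1n card_prod natrM.
have -> : \sum_(s : 'S_n) \sum_(e : {ffun 'I_n -> bool})
    (-1) ^+ e (s i) * (-1) ^+ e (s i) * Q (s i) (s i) =
    #|{: {ffun 'I_n -> bool}}|%:R * \sum_(s : 'S_n) Q (s i) (s i).
  rewrite mulr_sumr; apply: eq_bigr => s _.
  rewrite (eq_bigr (fun=> Q (s i) (s i))) ?sumr_const ?mulr_natl // => e _.
  by rewrite -expr2 sqrr_sign mul1r.
rewrite -mulrA -[in RHS]mulrA; congr (_ * _).
by rewrite mulrA -nS mulrAC divff ?mul1r // pnatr_eq0 -lt0n.
Qed.

End Twirl.

(* [g_sigma_algebraType] requires a pointed base type. *)
HB.instance Definition _ (R : realType) := isPointed.Build R[i] 0.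

(** * Integrals against a unitarily invariant law *)

Section Law.
Local Open Scope classical_set_scope.
Variables (R : realType) (d K : nat).
Notation C := R[i].
Notation N := (dimH d K).

(** The generators of [cBorel], named so that column vectors become a measurable space. *)
Definition halfspaces : set (set 'cV[C]_N) :=
  [set A | exists (i : 'I_N) (a : R),
     A = [set v : 'cV[C]_N | complex.Re (v i 0) < a] \/
     A = [set v : 'cV[C]_N | complex.Im (v i 0) < a]].

Notation borelcV := (g_sigma_algebraType halfspaces).

Lemma mxmeasurable_id : mxmeasurable (fun v : borelcV => (v : 'cV[C]_N)).
Proof.
move=> a b; rewrite ord1; split.
  apply: (measurability _ (RGenInftyO.measurableE R)) => _ /= -[_ [r ->] <-].
  apply: sub_sigma_algebra; exists a, r; left.
  by apply/seteqP; split => v /=; rewrite in_itv /=; [case | split].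
apply: (measurability _ (RGenInftyO.measurableE R)) => _ /= -[_ [r ->] <-].
apply: sub_sigma_algebra; exists a, r; right.
by apply/seteqP; split => v /=; rewrite in_itv /=; [case | split].
Qed.

Variables (dom : measure_display) (Omega : measurableType dom).

Lemma mxmeasurable_borel (phi : Omega -> 'cV[C]_N) : mxmeasurable phi ->
  measurable_fun setT (phi : Omega -> borelcV).
Proof.
move=> mphi; apply: (@measurability _ _ Omega borelcV setT phi halfspaces) => // _ [B [i [a BE]] <-].
have lt_measurable (f : Omega -> R) : measurable_fun setT f ->
    measurable [set w | f w < a].
  move=> mf; rewrite [X in measurable X](_ : _ = setT `&` f @^-1` `]-oo, a[).
    by apply: mf => //; exact: measurable_itv.
  by apply/seteqP; split => w /=; rewrite in_itv /=; [split | case].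
rewrite setTI; have [mr mi] := mphi i 0.
by case: BE => ->; exact: lt_measurable.
Qed.

Variables (Pr : probability Omega R) (Psi : Omega -> 'cV[C]_N).
Hypothesis mPsi : mxmeasurable Psi.
Hypothesis unitary_invariant : forall U : 'M[C]_N, unitary U ->
  forall A, @cBorel R d K A ->
    Pr (Psi @^-1` A) = Pr ((fun w => U *m Psi w) @^-1` A).

(** Both sides integrate [X] against image laws, which agree on Borel sets. *)
Lemma integral_unitary (X : 'cV[C]_N -> R) (U : 'M[C]_N) : unitary U ->
  measurable_fun setT (X : borelcV -> R) -> (forall v, 0 <= X v) ->
  (\int[Pr]_w (X (U *m Psi w))%:E = \int[Pr]_w (X (Psi w))%:E)%E.
Proof.
move=> unitU mX X0.
have mU : mxmeasurable (fun w => U *m Psi w).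
  by apply: mxmeasurableM => //; exact: mxmeasurable_cst.
have mEX : measurable_fun setT (EFin \o X : borelcV -> \bar R).
  exact/measurable_EFinP.
have EX0 : {in [set: borelcV], forall v, (0%R <= (EFin \o X) v)%E}.
  by move=> v _; rewrite lee_fin.
have mPsiB := mxmeasurable_borel mPsi.
have mUB := mxmeasurable_borel mU.
have := ge0_integral_pushforward mUB Pr measurableT mEX EX0.
rewrite preimage_setT => <-.
have := ge0_integral_pushforward mPsiB Pr measurableT mEX EX0.
rewrite preimage_setT => <-.
apply: eq_measure_integral => A mA _; apply/esym; exact: unitary_invariant.
Qed.

(** The sum of [X] over all signed permutations is constant by twirling, while its terms all have
    the same integral. *)
Lemma integral_projector (Q : 'M[C]_N) : adj Q = Q -> Q *m Q = Q ->
  (forall w, adj (Psi w) *m Psi w = 1%:M) ->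
  (\int[Pr]_w (complex.Re ((adj (Psi w) *m Q *m Psi w) 0 0))%:E =
    ((\rank Q)%:R / N%:R)%:E)%E.
Proof.
move=> aQ QQ unitPsi.
pose X (v : 'cV[C]_N) : R := complex.Re ((adj v *m Q *m v) 0 0).
have X0 v : 0 <= X v by apply: Re_ge0; exact: projector_form_ge0.
have mX : measurable_fun setT (X : borelcV -> R).
  suff m : mxmeasurable (fun v : borelcV => adj (v : 'cV[C]_N) *m Q *m v).
    by have [] := m 0 0.
  apply: mxmeasurableM; last exact: mxmeasurable_id.
  apply: mxmeasurableM; last exact: mxmeasurable_cst.
  by apply: mxmeasurable_adj; exact: mxmeasurable_id.
rewrite -[LHS]/(\int[Pr]_w (X (Psi w))%:E)%E.
pose G := ({ffun 'I_N -> bool} * 'S_N)%type.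
have sumX w : \sum_(g : G) X (signed_perm_mx R g *m Psi w) =
    #|{: G}|%:R * ((\rank Q)%:R / N%:R).
  rewrite /X -Re_sum.
  have -> : \sum_(g : G) (adj (signed_perm_mx R g *m Psi w) *m Q *m
      (signed_perm_mx R g *m Psi w)) 0 0 =
      (adj (Psi w) *m (\sum_(g : G) adj (signed_perm_mx R g) *m Q *m
        signed_perm_mx R g) *m Psi w) 0 0.
    rewrite mulmx_sumr mulmx_suml summxE; apply: eq_bigr => g _.
    by rewrite adjM !mulmxA.
  rewrite signed_perm_twirl mul_mx_scalar -scalemxAl unitPsi !mxE mulr1.
  rewrite mxtrace_idem //.
  rewrite (_ : _ / _ = (#|{: G}|%:R * ((\rank Q)%:R / N%:R))%:C%C) //.
  by rewrite !rmorphM fmorphV !rmorph_nat mulrA.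
have mXU (g : G) : measurable_fun setT (fun w => (X (signed_perm_mx R g *m Psi w))%:E).
  apply/measurable_EFinP.
  have mU : mxmeasurable (fun w => signed_perm_mx R g *m Psi w).
    by apply: mxmeasurableM => //; exact: mxmeasurable_cst.
  exact: (measurableT_comp mX (mxmeasurable_borel mU)).
have XU0 (g : G) w : setT w -> (0%R <= (X (signed_perm_mx R g *m Psi w))%:E)%E.
  by rewrite lee_fin.
have sum_int := ge0_integral_sum Pr measurableT mXU XU0 (index_enum G).
rewrite (eq_bigr (fun=> 1%:E * \int[Pr]_w (X (Psi w))%:E)%E) in sum_int; last first.
  move=> g _; rewrite mul1e; apply: integral_unitary => //.
  exact: signed_perm_unitary.
rewrite -ge0_sume_distrl // sumEFin sumr_const in sum_int.
rewrite (eq_integral (cst (#|{: G}|%:R * ((\rank Q)%:R / N%:R))%:E)) in sum_int; last first.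
  by move=> w _; rewrite sumEFin sumX.
rewrite integral_cst //= probability_setT mule1 in sum_int.
have G0 : 0 < #|{: G}|%:R :> R.
  by rewrite ltr0n; apply/card_gt0P; exists ([ffun=> false], 1%g).
rewrite (_ : #|xpredT| = #|{: G}|) in sum_int; last exact: eq_card.
(* The other side of [sum_int] is finite, which rules out infinite values. *)
case: (\int[Pr]_w (X (Psi w))%:E)%E sum_int => [r||].
- rewrite -EFinM; case=> qr; congr (_%:E).
  by apply: (mulfI (lt0r_neq0 G0)); rewrite -qr.
- by rewrite gt0_muley ?lte_fin.
- by rewrite gt0_muleNy ?lte_fin.
Qed.

End Law.

(** * Fidelity in terms of the complementary projector *)

Section Fidelity.
Variables (R : realType) (d K : nat).
Notation C := R[i].
Notation N := (dimH d K).
Implicit Types (P rho : 'M[C]_N) (psi : 'cV[C]_N).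

(** With [t] the weight of [psi] on [1 - P], the fidelity is [(1 - t)^2 + t * r] where [t] and [r]
    are nonnegative. *)
Lemma fid_ge P rho psi : P *m P = P -> adj P = P -> density rho ->
  adj psi *m psi = 1%:M ->
  1 - 2 * complex.Re ((adj psi *m (1%:M - P) *m psi) 0 0) <= fid P rho psi.
Proof.
move=> PP aP [_ rho_ge0] unit_psi.
pose q := (adj psi *m P *m psi) 0 0; pose t := (adj psi *m (1%:M - P) *m psi) 0 0.
pose r := (adj psi *m rho *m psi) 0 0.
have r0 : 0 <= r by exact: rho_ge0.
have t0 : 0 <= t.
  apply: projector_form_ge0; first by rewrite adjB aP adj_id.
  by rewrite mulmxBl mul1mx mulmxBr mulmx1 PP subrr subr0.
have qE : q = 1 - t.
  have -> : t = 1 - q; last by rewrite subKr.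
  by rewrite /t mulmxBr mulmx1 mulmxBl unit_psi mxE [X in _ + X]mxE -/q mxE.
have trE : \tr ((1%:M - P) *m (psi *m adj psi)) = t.
  by rewrite mulmxA mxtrace_mulC mulmxA /mxtrace big_ord1.
have fE : (adj psi *m chanE P rho (psi *m adj psi) *m psi) 0 0 = q * q + t * r.
  rewrite /chanE trE mulmxDr mulmxDl mxE; congr (_ + _).
    rewrite -/q (_ : adj psi *m _ *m psi = (adj psi *m P *m psi) *m (adj psi *m P *m psi)).
      by rewrite mxE big_ord1.
    by rewrite !mulmxA.
  by rewrite -scalemxAr -scalemxAl mxE.
have : 1 - 2 * t <= q * q + t * r.
  rewrite qE -subr_ge0 (_ : _ - _ = t * t + t * r); last by ring.
  by rewrite addr_ge0 ?mulr_ge0.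
rewrite /fid fE lecE => /andP[_]; apply: le_trans.
by rewrite /t; case: (_ 0 0) => u v /=; lra.
Qed.

End Fidelity.

Theorem theorem2 (R : realType) (d K : nat) (J eps : R)
  (dom : measure_display) (Omega : measurableType dom)
  (Pr : probability Omega R)
  (Psi : Omega -> 'cV[R[i]]_(dimH d K))
  (P rho0 : 'M[R[i]]_(dimH d K)) :
  (2 <= d)%N -> (1 <= K)%N -> 0 <= J -> 0 < eps ->
  (* P is the orthogonal projector P^{(K)}_J onto H^{(K)}_J *)
  orth_proj P (HJ d K J) ->
  (* rho0 is a density matrix supported in H^{(K)}_J *)
  density rho0 -> (colspace rho0 <= HJ d K J)%MS ->
  (* Psi is a random unit vector, measurable, with unitarily invariant law *)
  (forall w, adj (Psi w) *m Psi w = 1%:M) ->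
  (forall i : 'I_(dimH d K),
      measurable_fun setT (fun w => complex.Re (Psi w i 0)) /\
      measurable_fun setT (fun w => complex.Im (Psi w i 0))) ->
  (forall U : 'M[R[i]]_(dimH d K), unitary U ->
     forall A, @cBorel R d K A ->
       Pr (Psi @^-1` A)%classic = Pr ((fun w => U *m Psi w) @^-1` A)%classic) ->
  (Pr [set w | (fid P rho0 (Psi w) < 1 - eps)%R]%classic
   < ((2 * ((K.+1)%:R) ^+ ((d * (d - 1)) %/ 2) / eps)
      * expR (- (2 * J ^+ 2) / K%:R))%:E)%E.
Proof.
move=> d2 K1 J0 eps0 projP rho_dens _ unitPsi measPsi invPsi.
have [PP [aP _]] := projP.
have mPsi : mxmeasurable Psi by move=> a b; rewrite ord1.
pose Q : 'M[R[i]]_(dimH d K) := 1%:M - P.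
have aQ : adj Q = Q by rewrite adjB aP adj_id.
have QQ : Q *m Q = Q := complement_idem projP.
pose X w := complex.Re ((adj (Psi w) *m Q *m Psi w) 0 0).
have X0 w : 0 <= X w by apply: Re_ge0; exact: projector_form_ge0.
have intX := integral_projector mPsi invPsi aQ QQ unitPsi.
have mform (M : Omega -> 'M[R[i]]_(dimH d K)) : mxmeasurable M ->
    measurable_fun setT (fun w => complex.Re ((adj (Psi w) *m M w *m Psi w) 0 0)).
  move=> mM; suff m : mxmeasurable (fun w => adj (Psi w) *m M w *m Psi w).
    by have [] := m 0 0.
  by apply: mxmeasurableM => //; apply: mxmeasurableM => //; exact: mxmeasurable_adj.
have mX : measurable_fun setT X by apply: mform; exact: mxmeasurable_cst.
have mfid : measurable_fun setT (fun w => fid P rho0 (Psi w)).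
  have mpp : mxmeasurable (fun w => Psi w *m adj (Psi w)).
    by apply: mxmeasurableM => //; exact: mxmeasurable_adj.
  apply: mform; apply: mxmeasurableD; last first.
    apply: mxmeasurableZ; last exact: mxmeasurable_cst.
    by apply: cmeasurable_tr; apply: mxmeasurableM => //; exact: mxmeasurable_cst.
  apply: mxmeasurableM; last exact: mxmeasurable_cst.
  by apply: mxmeasurableM => //; exact: mxmeasurable_cst.
set A := [set w | _]%classic.
have mA : measurable A.
  rewrite (_ : A = setT `&` (fun w => fid P rho0 (Psi w)) @^-1` `]-oo, 1 - eps[)%classic.
    by apply: mfid => //; exact: measurable_itv.
  by apply/seteqP; split => w /=; rewrite /A /= in_itv /=; [split | case].
have mEX : measurable_fun setT (fun w => (X w)%:E) by exact/measurable_EFinP.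
(* By [fid_ge], a fidelity below [1 - eps] forces [X] above [eps / 2], whence the factor 2 in the
   bound. *)
have markov : ((eps / 2)%:E * Pr A <= ((\rank Q)%:R / (dimH d K)%:R)%:E)%E.
  rewrite -intX -integral_cst //.
  apply: (@le_trans _ _ (\int[Pr]_(w in A) (X w)%:E)%E).
    apply: ge0_le_integral => //=.
    - by move=> w _; rewrite lee_fin divr_ge0 // ltW.
    - exact: measurable_funTS.
    - move=> w Aw; rewrite lee_fin.
      have := fid_ge PP aP rho_dens (unitPsi w); rewrite -/(X w) => fX.
      by have := le_lt_trans fX Aw; lra.
  by apply: ge0_subset_integral => // w _; rewrite lee_fin.
have PrA : Pr A \is a fin_num by exact: fin_num_measure.
rewrite -(fineK PrA) -EFinM lee_fin in markov *.
rewrite -(fineK PrA) lte_fin.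
have N0 : 0 < (dimH d K)%:R :> R.
  by rewrite /dimH card_ffun !card_ord ltr0n expn_gt0 (ltnW d2).
have NE : (dimH d K)%:R = d%:R ^+ K :> R.
  by rewrite /dimH card_ffun !card_ord natrX.
pose D : R := K.+1%:R ^+ ((d * (d - 1)) %/ 2).
have D0 : 0 < D by rewrite exprn_gt0 // ltr0n.
(* Strictness comes from [card_bad_lt], whose factor [d ^ K] is the dimension and cancels. *)
have rkQ : (\rank Q)%:R < (dimH d K)%:R * (D * expR (- (2 * J ^+ 2) / K%:R)).
  apply: (@le_lt_trans _ _ (D * #|[set x : word d K | bad J x]|%:R)).
    by rewrite /D -natrX -natrM ler_nat; exact: mxrank_complement_le.
  by rewrite mulrCA ltr_pM2l // NE; exact: card_bad_lt.
have {}rkQ : (\rank Q)%:R / (dimH d K)%:R < D * expR (- (2 * J ^+ 2) / K%:R).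
  by rewrite ltr_pdivrMr // mulrC.
have := le_lt_trans markov rkQ; rewrite -/D -ltr_pdivlMl ?divr_gt0 // => /lt_le_trans; apply.
by rewrite le_eqVlt; apply/orP; left; apply/eqP; field; rewrite gt_eqF.
Qed.
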